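(* Let $M=(M^3,\varphi,\xi,\eta,g)$ be an almost contact metric three-manifold with Ricci operator $Q$. Suppose that $M$ is weakly Einstein but not Einstein on an open subset $\mathcal{U}$. Then, locally on $\mathcal{U}$, there exist a nonzero smooth function $\lambda$ and a unit vector field $V$ such that $$QX=\lambda g(X,V)V$$ for all vector fields $X$ on $\mathcal{U}$. According to the position of $V$ relative to $D=\ker\eta$ and $\mathbb R\xi$, one of the following cases occurs. (i) If $V\in D$, then there exists a local $\varphi$-orthonormal frame $\{e_1,e_2=\varphi e_1,\xi\}$ such that $$Qe_1=\lambda e_1,\qquad Qe_2=0,\qquad Q\xi=0.$$ (ii) If $V\in\mathbb R\xi$, then $QX=\lambda\eta(X)\xi$. Thus the metric is $\eta$-Einstein. (iii) If $V\notin D$ and $V\notin\mathbb R\xi$, then with respect to a local $\varphi$-orthonormal frame $\{e_1,e_2=\varphi e_1,\xi\}$, one can write $$V=\sin\theta\,e_1+\cos\theta\,\xi,\qquad 0<|\sin\theta|<1.$$ Moreover, $$Q=\begin{pmatrix}\lambda\sin^2\theta&0&\lambda\sin\theta\cos\theta\\0&0&0\\\lambda\sin\theta\cos\theta&0&\lambda\cos^2\theta\end{pmatrix}$$ with respect to this frame.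
   Context: All vector fields are assumed to be smooth. An almost contact metric structure on a smooth manifold $M^{2n+1}$ is a quadruple $(\varphi,\xi,\eta,g)$, where $\varphi$ is a tensor field of type $(1,1)$, $\xi$ is a vector field, $\eta$ is a one-form and $g$ is a Riemannian metric such that $\varphi^2=-I+\eta\otimes\xi$, $\eta(\xi)=1$ and $g(\varphi X,\varphi Y)=g(X,Y)-\eta(X)\eta(Y)$ for all vector fields $X,Y$. These identities imply $\varphi\xi=0$, $\eta\circ\varphi=0$, $\eta(X)=g(X,\xi)$ and the orthogonal decomposition $TM=D\oplus\mathbb R\xi$ with $D=\ker\eta$, where $\mathbb R\xi$ is the line field generated by $\xi$. In dimension three, a local $\varphi$-orthonormal frame is a local orthonormal frame of the form $\{e_1,e_2=\varphi e_1,\xi\}$. The curvature tensor is $R(X,Y)Z=\nabla_X\nabla_YZ-\nabla_Y\nabla_XZ-\nabla_{[X,Y]}Z$, where $\nabla$ is the Levi-Civita connection, and $R(X,Y,Z,W)=g(R(X,Y)Z,W)$. The Ricci tensor is $\rho(Y,Z)=\sum_i R(e_i,Y,Z,e_i)$ for a local orthonormal frame $\{e_i\}$, and the Ricci operator $Q$ is defined by $g(QX,Y)=\rho(X,Y)$. A Riemannian manifold $(M^m,g)$ is weakly Einstein if $\breve R=\frac{|R|^2}{m}g$, where $\breve R(X,Y)=\sum_{i,j,k=1}^m R(X,e_i,e_j,e_k)R(Y,e_i,e_j,e_k)$ for a local orthonormal frame $\{e_i\}$ and $|R|^2=\sum_{i,j,k,l}R(e_i,e_j,e_k,e_l)^2$.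 A metric is Einstein if its Ricci operator is a scalar multiple of the identity. An almost contact metric manifold is $\eta$-Einstein if $\rho=\overline{\alpha}g+\overline{\beta}\,\eta\otimes\eta$ for some smooth functions $\overline{\alpha}$ and $\overline{\beta}$. *)

(* Defs.v *)
From HB Require Import structures.
From mathcomp Require Import all_boot all_order all_algebra.
From mathcomp Require Import all_classical all_reals all_analysis.
Set Implicit Arguments.
Unset Strict Implicit.
Unset Printing Implicit Defensive.
Import Order.TTheory GRing.Theory Num.Theory.
Import numFieldNormedType.Exports.
Local Open Scope classical_set_scope.
Local Open Scope ring_scope.

(* C^k on an open subset of R^n: all iterated directional derivatives up to
   order k exist and are continuous. *)
Fixpoint Ck_on (R : realType) (n : nat) (E : normedModType R) (k : nat)
    (A : set 'rV[R]_n) (f : 'rV[R]_n -> E) : Prop :=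
  (forall x, A x -> {for x, continuous f}) /\
  (if k is k'.+1 then
     forall v : 'rV[R]_n, (forall x, A x -> derivable f x v) /\
                          Ck_on k' A (fun x => 'D_v f x)
   else True).

Definition smooth_on (R : realType) (n : nat) (E : normedModType R)
    (A : set 'rV[R]_n) (f : 'rV[R]_n -> E) : Prop :=
  forall k, Ck_on k A f.

(* A manifold carries an atlas and, for each p, the choice of one chart
   [chart_at p] around p.  The tangent space at p is then 'rV[R]_n, a tangent
   vector being given by its components in the chart [chart_at p]; its
   components in the other charts are obtained with the differential of the
   transition map (see [tcomp]).  Maps defined on a chart domain or on its
   image are total functions whose values elsewhere are irrelevant. *)
Record smooth_manifold (R : realType) (n : nat) := SmoothManifold {
  mf_points :> topologicalType;
  chart : Type;
  chart_dom : chart -> set mf_points;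
  chart_map : chart -> mf_points -> 'rV[R]_n;
  chart_inv : chart -> 'rV[R]_n -> mf_points;
  chart_at : mf_points -> chart;
  manifold_hausdorff : hausdorff_space mf_points;
  manifold_countable : @second_countable mf_points;
  chart_dom_open : forall c, open (chart_dom c);
  chart_img_open : forall c, open (chart_map c @` chart_dom c);
  chart_mapK : forall c p, chart_dom c p -> chart_inv c (chart_map c p) = p;
  chart_map_continuous : forall c p, chart_dom c p ->
    {for p, continuous (chart_map c)};
  chart_inv_continuous : forall c x, (chart_map c @` chart_dom c) x ->
    {for x, continuous (chart_inv c)};
  chart_atP : forall p, chart_dom (chart_at p) p;
  transition_smooth : forall c d,
    smooth_on (chart_map c @` (chart_dom c `&` chart_dom d))
      (chart_map d \o chart_inv c)
}.

Section Fields.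
Context (R : realType) (n : nat) (M : smooth_manifold R n).

Definition vfield : Type := M -> 'rV[R]_n.

(* Endomorphisms act on row vectors on the right: the image of v at p is
   [v *m F p]. *)
Definition endo_field : Type := M -> 'M[R]_n.

Definition smooth_fun (W : set M) (f : M -> R) : Prop :=
  forall c, smooth_on (chart_map c @` (chart_dom c `&` W)) (f \o chart_inv c).

Definition tcomp (c : chart M) (p : M) (v : 'rV[R]_n) : 'rV[R]_n :=
  'D_v (chart_map c \o chart_inv (chart_at p)) (chart_map (chart_at p) p).

Definition field_comp (c : chart M) (X : vfield) : 'rV[R]_n -> 'rV[R]_n :=
  fun x => tcomp c (chart_inv c x) (X (chart_inv c x)).

Definition smooth_vfield (W : set M) (X : vfield) : Prop :=
  forall c, smooth_on (chart_map c @` (chart_dom c `&` W)) (field_comp c X).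

Definition dirder (X : vfield) (f : M -> R) : M -> R :=
  fun p => 'D_(X p) (f \o chart_inv (chart_at p)) (chart_map (chart_at p) p).

Definition lie_bracket (X Y : vfield) : vfield := fun p =>
  let c := chart_at p in
  'D_(X p) (field_comp c Y) (chart_map c p) -
  'D_(Y p) (field_comp c X) (chart_map c p).

Definition bilin (G : 'M[R]_n) (u v : 'rV[R]_n) : R := (u *m G *m v^T) 0 0.

(* Tensor fields are smooth when they send smooth local fields to smooth ones. *)
Record riemannian_metric := RiemannianMetric {
  gram : M -> 'M[R]_n;
  gram_sym : forall p u v, bilin (gram p) u v = bilin (gram p) v u;
  gram_posdef : forall p u, u != 0 -> 0 < bilin (gram p) u u;
  gram_smooth : forall (W : set M) (X Y : vfield), open W ->
    smooth_vfield W X -> smooth_vfield W Y ->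
    smooth_fun W (fun p => bilin (gram p) (X p) (Y p))
}.

Definition inner (g : riemannian_metric) (p : M) (u v : 'rV[R]_n) : R :=
  bilin (gram g p) u v.

(* An operator on all (not necessarily smooth) fields; only its values, over
   an open set W, on fields that are smooth on W are constrained below. *)
Definition connection : Type := vfield -> vfield -> vfield.

Record is_levi_civita (g : riemannian_metric) (nab : connection) : Prop := {
  nab_smooth : forall (W : set M) (X Y : vfield), open W ->
    smooth_vfield W X -> smooth_vfield W Y -> smooth_vfield W (nab X Y);
  nab_addl : forall (W : set M) (X X' Y : vfield), open W ->
    smooth_vfield W X -> smooth_vfield W X' -> smooth_vfield W Y ->
    forall p, W p -> nab (fun q => X q + X' q) Y p = nab X Y p + nab X' Y p;
  nab_scalel : forall (W : set M) (f : M -> R) (X Y : vfield), open W ->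
    smooth_fun W f -> smooth_vfield W X -> smooth_vfield W Y ->
    forall p, W p -> nab (fun q => f q *: X q) Y p = f p *: nab X Y p;
  nab_addr : forall (W : set M) (X Y Y' : vfield), open W ->
    smooth_vfield W X -> smooth_vfield W Y -> smooth_vfield W Y' ->
    forall p, W p -> nab X (fun q => Y q + Y' q) p = nab X Y p + nab X Y' p;
  nab_leibniz : forall (W : set M) (f : M -> R) (X Y : vfield), open W ->
    smooth_fun W f -> smooth_vfield W X -> smooth_vfield W Y ->
    forall p, W p ->
      nab X (fun q => f q *: Y q) p = f p *: nab X Y p + dirder X f p *: Y p;
  nab_torsion_free : forall (W : set M) (X Y : vfield), open W ->
    smooth_vfield W X -> smooth_vfield W Y ->
    forall p, W p -> nab X Y p - nab Y X p = lie_bracket X Y p;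
  nab_metric : forall (W : set M) (X Y Z : vfield), open W ->
    smooth_vfield W X -> smooth_vfield W Y -> smooth_vfield W Z ->
    forall p, W p ->
      dirder X (fun q => inner g q (Y q) (Z q)) p =
      inner g p (nab X Y p) (Z p) + inner g p (Y p) (nab X Z p)
}.

Definition curv (nab : connection) (X Y Z : vfield) : vfield := fun p =>
  nab X (nab Y Z) p - nab Y (nab X Z) p - nab (lie_bracket X Y) Z p.

Section Curvature.
Context (g : riemannian_metric) (nab : connection).

Definition curv4 (X Y Z T : vfield) : M -> R :=
  fun p => inner g p (curv nab X Y Z p) (T p).

Definition orthonormal_frame (W : set M) (e : 'I_n -> vfield) : Prop :=
  (forall i, smooth_vfield W (e i)) /\
  (forall p, W p -> forall i j, inner g p (e i p) (e j p) = (i == j)%:R).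

Definition ricci (e : 'I_n -> vfield) (X Y : vfield) : M -> R :=
  fun p => \sum_i curv4 (e i) X Y (e i) p.

Definition breveR (e : 'I_n -> vfield) (X Y : vfield) : M -> R := fun p =>
  \sum_i \sum_j \sum_k curv4 X (e i) (e j) (e k) p * curv4 Y (e i) (e j) (e k) p.

Definition curv_norm2 (e : 'I_n -> vfield) : M -> R := fun p =>
  \sum_i \sum_j \sum_k \sum_l curv4 (e i) (e j) (e k) (e l) p ^+ 2.

(* The three contractions above do not depend on the orthonormal frame, so the
   notions below may refer to all local orthonormal frames. *)
Definition is_ricci_operator (Q : endo_field) : Prop :=
  forall (W : set M) (e : 'I_n -> vfield) (X Y : vfield), open W ->
    orthonormal_frame W e -> smooth_vfield W X -> smooth_vfield W Y ->
    forall p, W p -> inner g p (X p *m Q p) (Y p) = ricci e X Y p.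

Definition weakly_einstein_on (U : set M) : Prop :=
  forall (W : set M) (e : 'I_n -> vfield) (X Y : vfield), open W -> W `<=` U ->
    orthonormal_frame W e -> smooth_vfield W X -> smooth_vfield W Y ->
    forall p, W p ->
      breveR e X Y p = curv_norm2 e p / n%:R * inner g p (X p) (Y p).

End Curvature.

Definition einstein_at (Q : endo_field) (p : M) : Prop :=
  exists c : R, forall v : 'rV[R]_n, v *m Q p = c *: v.

(* Columns of A are the images of the frame: Q e_j = \sum_i A_ij e_i. *)
Definition is_matrix_of (Q : endo_field) (e : 'I_n -> vfield) (p : M)
    (A : 'M[R]_n) : Prop :=
  forall j, e j p *m Q p = \sum_i A i j *: e i p.

Definition pairing (a : 'cV[R]_n) (v : 'rV[R]_n) : R := (v *m a) 0 0.

Record almost_contact_metric := AlmostContactMetric {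
  acm_metric :> riemannian_metric;
  acm_phi : endo_field;
  acm_xi : vfield;
  acm_eta_covec : M -> 'cV[R]_n;
  xi_smooth : smooth_vfield setT acm_xi;
  phi_smooth : forall (W : set M) (X : vfield), open W ->
    smooth_vfield W X -> smooth_vfield W (fun p => X p *m acm_phi p);
  eta_smooth : forall (W : set M) (X : vfield), open W ->
    smooth_vfield W X -> smooth_fun W (fun p => pairing (acm_eta_covec p) (X p));
  phi_phi : forall p v, v *m acm_phi p *m acm_phi p =
    - v + pairing (acm_eta_covec p) v *: acm_xi p;
  eta_xi : forall p, pairing (acm_eta_covec p) (acm_xi p) = 1;
  phi_inner : forall p u v,
    inner acm_metric p (u *m acm_phi p) (v *m acm_phi p) =
    inner acm_metric p u v -
    pairing (acm_eta_covec p) u * pairing (acm_eta_covec p) v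
}.

Definition acm_eta (S : almost_contact_metric) (p : M) (v : 'rV[R]_n) : R :=
  pairing (acm_eta_covec S p) v.

Definition in_D (S : almost_contact_metric) (p : M) (v : 'rV[R]_n) : Prop :=
  acm_eta S p v = 0.

Definition in_Rxi (S : almost_contact_metric) (p : M) (v : 'rV[R]_n) : Prop :=
  exists c : R, v = c *: acm_xi S p.

Definition eta_einstein_on (S : almost_contact_metric) (nab : connection)
    (A : set M) : Prop :=
  exists alpha beta : M -> R,
    [/\ smooth_fun A alpha, smooth_fun A beta &
      forall (W : set M) (e : 'I_n -> vfield) (X Y : vfield),
        open W -> W `<=` A ->
        orthonormal_frame S W e -> smooth_vfield W X -> smooth_vfield W Y ->
        forall p, W p ->
          ricci S nab e X Y p =
          alpha p * inner S p (X p) (Y p) +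
          beta p * (acm_eta S p (X p) * acm_eta S p (Y p))].

End Fields.

Definition frame3 (R : realType) (M : smooth_manifold R 3)
    (e1 e2 e3 : vfield M) : 'I_3 -> vfield M :=
  tnth [tuple e1; e2; e3].

Definition phi_orthonormal_frame (R : realType) (M : smooth_manifold R 3)
    (S : almost_contact_metric M) (W : set M) (e1 e2 : vfield M) : Prop :=
  orthonormal_frame S W (frame3 e1 e2 (acm_xi S)) /\
  (forall p, W p -> e2 p = e1 p *m acm_phi S p).

Definition mx3 (R : realType) (rows : seq (seq R)) : 'M[R]_3 :=
  \matrix_(i < 3, j < 3) nth 0 (nth [::] rows i) j.

(* Main.v *)
Require Import Defs.
From HB Require Import structures.
From mathcomp Require Import all_boot all_order all_algebra.
From mathcomp Require Import all_classical all_reals all_analysis.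
From mathcomp Require Import ring lra.
Import Order.TTheory GRing.Theory Num.Theory.
Import numFieldNormedType.Exports.
Local Open Scope classical_set_scope.
Local Open Scope ring_scope.
Set Implicit Arguments.
Unset Strict Implicit.
Unset Printing Implicit Defensive.

(** The curvature is a symmetric form on bivectors, and in dimension three Hodge duality
    identifies bivectors with vectors, which makes it a symmetric matrix [A] in an
    orthonormal frame. In these terms the Ricci operator is [A] minus its trace, and
    being weakly Einstein means that the square of [A] is a scalar. The eigenvalues of
    [A] are then equal up to sign. If they are all equal, the metric is Einstein at the
    point. Otherwise they are [s, -s, -s] with [s] nonzero, the trace is [-s], and the
    Ricci operator has eigenvalues [2 * s, 0, 0]: it has rank one. This is
    [sym3_square_scalar] and [weakly_einstein_ricci3]; the argument uses adjugates and
    traces instead of eigenvalues, so that the unit vector and the factor [lam] come out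
    as explicit smooth functions of the Ricci components ([rank_one_ricci]).

    To feed this algebra, the components of the curvature in a frame must have the
    symmetries of an algebraic curvature tensor ([curv_antisym], [curv_skew],
    [curv_bianchi]). They follow from the axioms of the Levi-Civita connection once the
    Lie bracket is known to be the commutator of derivations ([dirder_lie_bracket]), to
    satisfy the Jacobi identity ([jacobi]), and the connection to be a local operator
    ([nab_addr_local]). The first of these facts rests on the symmetry of second
    derivatives ([derive_comm]), and the use of arbitrary charts on the chain rule
    ([C1_differentiable], [derive_chain]). Frames exist around every point because a
    chart provides fields with a prescribed value ([smooth_pushed_field]), and a field
    transverse to [xi] becomes a phi-orthonormal frame after normalizing its horizontal
    part ([phi_frame_of]).

    The three cases concern the angle [theta] between the Ricci direction [V] and [xi].
    If [V] is not a multiple of [xi], the frame is built from [V] itself, so that [V]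
    lies in the plane of the first frame vector and [xi], and [theta] is the arccosine
    of [eta V]; the matrix of the Ricci operator is then that of [lam] times the
    projection onto [V]. *)

(** * Directional derivatives and differentiability *)

Section DirectionalDerivatives.
Context (R : realType) (V : normedModType R).
Implicit Types (f : V -> R) (a x u v : V).

Lemma is_derive_line f a v (t : R) : derivable f (t *: v + a) v ->
  is_derive t 1 (fun s : R => f (s *: v + a)) ('D_v f (t *: v + a)).
Proof.
move=> /derivableP [fd fv].
have E : (fun h : R => h^-1 *: (((fun s : R => f (s *: v + a)) \o shift t) (h *: (1:R)) - f (t *: v + a)))
   = (fun h => h^-1 *: ((f \o shift (t *: v + a)) (h *: v) - f (t *: v + a))).
  by apply/funext => h /=; rewrite [_%:A]mulr1 scalerDl addrA.
by split; rewrite /derivable /derive E.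
Qed.

Lemma is_derive_line0 f a v : derivable f a v ->
  is_derive (0 : R) 1 (fun s : R => f (s *: v + a)) ('D_v f a).
Proof.
have E : 0 *: v + a = a by rewrite scale0r add0r.
by have := @is_derive_line f a v 0; rewrite E.
Qed.

(** The one-variable mean value theorem on the segment from [a] to [a + v]; every
    estimate below that compares values of a function goes through it. *)
Lemma mean_value_dir f a v :
  (forall t : R, 0 <= t <= 1 -> derivable f (t *: v + a) v) ->
  exists2 t : R, 0 <= t <= 1 & f (v + a) - f a = 'D_v f (t *: v + a).
Proof.
move=> fd.
have [|||t] := @MVT_segment R (fun s : R => f (s *: v + a))
   (fun t => 'D_v f (t *: v + a)) 0 1.
- exact: ler01.
- move=> t; rewrite in_itv/= => /andP[t0 t1]; apply: is_derive_line.
  by apply: fd; rewrite !ltW.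
- apply: derivable_within_continuous => t; rewrite in_itv/= => t01.
  by have [] := is_derive_line (fd t t01).
rewrite in_itv/= => t01; rewrite scale1r scale0r add0r subr0 mulr1 => E.
by exists t.
Qed.

(** Homogeneity in the direction asks only for derivability along [v], whereas
    additivity asks for differentiability; it is what allows the mean value theorem
    to be applied to short steps [c *: v]. *)
Lemma is_derive_scaledir f x v (c : R) : derivable f x v ->
  is_derive x (c *: v) f (c * 'D_v f x).
Proof.
have [->|c0] := eqVneq c 0.
  by move=> _; rewrite scale0r mul0r; exact: is_derive0.
move=> fd.
have d1 : is_derive (0 : R) (1:R) (fun s : R => f (s *: v + x)) ('D_v f x).
  exact: is_derive_line0.
have d2 : is_derive (0 : R) 1 ( *%R c) c.
  have := is_deriveZ c (is_derive_id (0 : R) 1).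
  by rewrite /GRing.scale/= mulr1.
have d1' : is_derive (c * 0) 1 (fun s : R => f (s *: v + x)) ('D_v f x).
  by rewrite mulr0.
have d3 := is_derive1_comp d1' d2.
have E : (fun s : R => f (s *: (c *: v) + x)) = ((fun s : R => f (s *: v + x)) \o ( *%R c)).
  by apply/funext => s /=; rewrite scalerA mulrC.
rewrite -E in d3.
have fcd : derivable f x (c *: v) by apply/derivable1P; case: d3.
split => //.
have [_ <-] := is_derive_line0 fcd.
by rewrite mulrC; case: d3.
Qed.

End DirectionalDerivatives.

Lemma differentiable_linear_approx (R : realType) (V W : normedModType R)
    (f : V -> W) (a : V) (L : {linear V -> W}) : continuous L ->
  (forall eps : R, 0 < eps ->
    \forall h \near (0 : V), `|f (h + a) - (f a + L h)| <= eps * `|h|) ->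
  differentiable f a.
Proof.
move=> Lc H.
have fE : f \o shift a = cst (f a) + L +o_ 0 id.
  by apply/eqaddoP => _/posnumP[eps]; apply: H.
have dE : 'd f a = L :> (V -> W) by apply: diff_unique.
by apply/diff_locallyP; rewrite dE; split; [exact: Lc|exact: fE].
Qed.

Section C1Differentiable.
Context (R : realType) (n : nat).
Local Notation V := 'rV[R]_n.
Local Notation e i := (delta_mx 0 i : V).

(** The vertices of the path from [0] to [h] along the axes. *)
Let trunc (k : nat) (h : V) : V := \row_i (if (i < k)%N then h 0 i else 0).

Lemma norm_row_le (h : V) (c : R) : 0 <= c ->
  (forall i, `|h 0 i| <= c) -> `|h| <= c.
Proof.
move=> c0 H; rewrite [leLHS]/Num.Def.normr/= mx_normrE.
by apply: bigmax_le => // -[i j] _ /=; rewrite ord1.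
Qed.

Lemma norm_coord_le (h : V) i : `|h 0 i| <= `|h|.
Proof.
rewrite [leRHS]/Num.Def.normr/= mx_normrE.
exact: (le_bigmax _ (fun ij => `|h ij.1 ij.2|) (0, i)).
Qed.

(** Partial derivatives that are continuous at [a] suffice for differentiability:
    walk from [a] to [a + h] along the coordinate axes, apply the mean value theorem
    on each edge, and compare each partial derivative met on the way with its value
    at [a].  In the maximum norm no vertex or edge of this path is farther from [a]
    than [h] is long. *)
Lemma C1_differentiable (A : set V) (f : V -> R) (a : V) :
  open A -> A a ->
  (forall (i : 'I_n) x, A x -> derivable f x (e i)) ->
  (forall (i : 'I_n), {for a, continuous ('D_(e i) f)}) ->
  differentiable f a.
Proof.
move=> oA Aa fd fc.
pose L (h : V) : R := \sum_i h 0 i * 'D_(e i) f a.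
have Llin : linear L.
  move=> c u v; rewrite /L scaler_sumr -big_split/=; apply: eq_bigr => i _.
  by rewrite !mxE mulrDl -mulrA.
pose LM := GRing.isLinear.Build _ _ _ _ L Llin.
pose LL : {linear V -> R} := HB.pack L LM.
have Lc : continuous LL.
  rewrite /= /L => x; apply: (@continuous_big _ _ +%R 0) => //.
    exact: add_continuous.
  move=> i _ y; apply: (@continuousM R V (fun x => x 0 i) (cst _) y).
    exact: coord_continuous.
  exact: cst_continuous.
apply: (differentiable_linear_approx Lc) => eps eps0.
(* the [n] edges share the error [eps]; [n.+1] keeps the quotient defined for [n = 0] *)
pose d := eps / n.+1%:R.
have d0 : 0 < d by rewrite divr_gt0.
have [r /= r0 rP] : exists2 r : R, 0 < r & forall x : V, `|x| < r ->
    A (x + a) /\ forall i : 'I_n, `|'D_(e i) f (x + a) - 'D_(e i) f a| <= d.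
  have : \forall x \near a, A x /\ forall i : 'I_n, `|'D_(e i) f x - 'D_(e i) f a| <= d.
    have Hi (i : 'I_n) : \forall x \near a, `|'D_(e i) f x - 'D_(e i) f a| <= d.
      have /cvgrPdist_le/(_ _ d0) := fc i.
      by apply: filterS => x; rewrite distrC.
    apply: filterI; first exact: open_nbhs_nbhs.
    exact: (@filter_forall _ _ _ _ (nbhs_filter a) Hi).
  move=> /nbhs_ballP[r/= r0 rP]; exists r => // x xr.
  by apply: rP; rewrite -ball_normE /ball_/= opprD addrCA subrr addr0 normrN.
near=> h.
have hr : `|h| < r.
  near: h; apply/nbhs_ballP; exists r => //= h.
  by rewrite -ball_normE /ball_/= sub0r normrN.
have step k : (k <= n)%N -> `|f (trunc k h + a) - f a -
    \sum_(i < n | (i < k)%N) h 0 i * 'D_(e i) f a| <= k%:R * (d * `|h|).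
  elim: k => [_|k IH kn].
    have -> : trunc 0 h = 0 by apply/rowP => i; rewrite !mxE.
    by rewrite add0r subrr big_pred0_eq subrr normr0 mul0r.
  pose i := Ordinal kn.
  have tE : trunc k.+1 h = h 0 i *: e i + trunc k h.
    apply/rowP => j; rewrite !mxE eqxx/= ltnS leq_eqVlt -val_eqE/=.
    have [jk|jk] := eqVneq (j : nat) k.
      by rewrite /= jk ltnn mulr1 addr0; congr (h _ _); apply: val_inj.
    by rewrite /= mulr0 add0r.
  have small (t : R) : 0 <= t <= 1 -> `|t *: (h 0 i *: e i) + trunc k h| < r.
    move=> /andP[t0 t1]; apply: le_lt_trans hr.
    apply: norm_row_le => // j; rewrite !mxE eqxx/= -val_eqE/=.
    have [jk|jk] := eqVneq (j : nat) k.
      rewrite jk ltnn mulr1 addr0 normrM ger0_norm//.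
      by rewrite (le_trans _ (norm_coord_le h i))// ler_piMl.
    rewrite mulr0 mulr0 add0r; case: ifP => _; first exact: norm_coord_le.
    by rewrite normr0.
  have [|t t01] := @mean_value_dir R V f (trunc k h + a) (h 0 i *: e i).
    move=> t t01; rewrite addrA.
    have [At _] := rP _ (small t t01).
    by have [] := is_derive_scaledir (h 0 i) (fd i _ At).
  rewrite addrA addrA -tE.
  have [At Dt] := rP _ (small t t01).
  rewrite (derive_val (is_derive := is_derive_scaledir (h 0 i) (fd i _ At))) => E.
  have SE : \sum_(j < n | (j < k.+1)%N) h 0 j * 'D_(e j) f a =
     \sum_(j < n | (j < k)%N) h 0 j * 'D_(e j) f a + h 0 i * 'D_(e i) f a.
    rewrite (bigD1 i)//= addrC; congr (_ + _); apply: eq_bigl => j.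
    by rewrite ltnS -val_eqE/= [RHS]ltn_neqAle andbC.
  rewrite SE -natr1 mulrDl mul1r.
  set z := t *: _ + _ + _ in E Dt At.
  rewrite (_ : _ - _ = (f (trunc k h + a) - f a -
    \sum_(j < n | (j < k)%N) h 0 j * 'D_(e j) f a) +
    h 0 i * ('D_(e i) f z - 'D_(e i) f a)); last first.
    by rewrite mulrBr -E; ring.
  apply: le_trans (ler_normD _ _) _; apply: lerD; first exact/IH/ltnW.
  rewrite normrM mulrC; apply: ler_pM => //; exact: norm_coord_le.
have := step n (leqnn n).
have -> : trunc n h = h by apply/rowP => i; rewrite !mxE ltn_ord.
rewrite (eq_bigl predT) => [|i]; last by rewrite ltn_ord.
rewrite /= opprD addrA => /le_trans; apply.
rewrite mulrA; apply: ler_wpM2r => //.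
rewrite /d mulrCA ger_pMr// ler_pdivrMr// mul1r ler_nat; exact: leqnSn.
Unshelve. all: by end_near. Qed.

End C1Differentiable.

(** * Symmetry of second derivatives *)

Section Schwarz.
Context (R : realType) (V : normedModType R).
Implicit Types (f : V -> R) (a x u v : V).

Lemma derive_translate f a x v : 'D_v (fun y => f (y + a)) x = 'D_v f (x + a).
Proof.
rewrite /derive; set F := (X in lim (X @ _)); set G := (X in _ = lim (X @ _)).
by suff -> : F = G by []; apply/funext => h; rewrite /F/G/= addrA.
Qed.

Lemma derivable_translate f a x v :
  derivable f (x + a) v -> derivable (fun y => f (y + a)) x v.
Proof.
rewrite /derivable; set F := (X in X @ _); set G := (X in _ -> cvg (X @ _)).
by suff -> : F = G by []; apply/funext => h; rewrite /F/G/= addrA.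
Qed.

Definition second_difference f x u v : R :=
  f (u + v + x) - f (u + x) - f (v + x) + f x.

(** Two applications of the mean value theorem turn the second difference into
    [s ^+ 2] times a second derivative at a point of the parallelogram spanned by
    [s *: u] and [s *: v], which shrinks to [x]. *)
Lemma second_difference_cvg (A : set V) f x u v :
  open A -> A x ->
  (forall y, A y -> derivable f y u) ->
  (forall y, A y -> derivable ('D_u f) y v) ->
  {for x, continuous ('D_v ('D_u f))} ->
  (s ^+ 2)^-1 * second_difference f x (s *: u) (s *: v) @[s --> 0^'] -->
    'D_v ('D_u f) x.
Proof.
move=> oA Ax fu fuv cont; apply/cvgrPdist_le => /= eps eps0.
have [r /= r0 rP] : exists2 r : R, 0 < r & forall y : V, `|y| < r ->
    A (y + x) /\ `|'D_v ('D_u f) x - 'D_v ('D_u f) (y + x)| <= eps.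
  have : \forall y \near x, A y /\ `|'D_v ('D_u f) x - 'D_v ('D_u f) y| <= eps.
    apply: filterI; first exact: open_nbhs_nbhs.
    by have /cvgrPdist_le/(_ _ eps0) := cont.
  move=> /nbhs_ballP[r/= r0 rP]; exists r => // y yr.
  apply: rP; rewrite -ball_normE /ball_/= opprD addrCA subrr addr0 normrN//.
(* the final 1 keeps this bound positive when [u] and [v] vanish *)
pose c := `|u| + `|v| + 1.
have c0 : 0 < c by rewrite ltr_wpDl// addr_ge0.
near=> s.
have s0 : s != 0 by near: s; exact: nbhs_dnbhs_neq.
have sr : `|s| * c < r.
  rewrite -ltr_pdivlMr//; near: s; apply: dnbhs0_lt; exact: divr_gt0.
have small (p q : R) : 0 <= p <= 1 -> 0 <= q <= 1 ->
    `|p *: (s *: u) + q *: (s *: v)| < r.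
  move=> /andP[p0 p1] /andP[q0 q1]; apply: le_lt_trans sr.
  apply: le_trans (ler_normD _ _) _; rewrite !normrZ /c !mulrDr mulr1.
  rewrite (ger0_norm p0) (ger0_norm q0).
  have H : 0 <= `|s| by [].
  apply: (@le_trans _ _ (`|s| * `|u| + `|s| * `|v|)); last by rewrite lerDl.
  by apply: lerD; rewrite ler_piMl// mulr_ge0.
have smallA p q : 0 <= p <= 1 -> 0 <= q <= 1 ->
    A (p *: (s *: u) + q *: (s *: v) + x).
  by move=> p01 q01; have [] := rP _ (small p q p01 q01).
have I0 : 0 <= (0:R) <= 1 by rewrite lexx ler01.
have I1 : 0 <= (1:R) <= 1 by rewrite lexx ler01.
pose phi y := f (y + s *: v) - f y.
have phid y : A y -> A (y + s *: v) -> is_derive y u phi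
    ('D_u f (y + s *: v) - 'D_u f y).
  move=> Ay Ayv; apply: is_deriveB.
  - split; first exact/derivable_translate/fu.
    exact: derive_translate.
  - exact/derivableP/fu.
have phis p : 0 <= p <= 1 -> is_derive (p *: (s *: u) + x) u phi
    ('D_u f (p *: (s *: u) + x + s *: v) - 'D_u f (p *: (s *: u) + x)).
  move=> p01; apply: phid.
    by have := smallA p 0 p01 I0; rewrite scale0r addr0.
  by have := smallA p 1 p01 I1; rewrite scale1r addrAC.
have [p p01|p p01 E1] := @mean_value_dir R V phi x (s *: u).
  by have [] := @is_derive_scaledir R V phi _ u s (ex_derive (is_derive := phis p p01)).
rewrite (derive_val (is_derive := is_derive_scaledir s (ex_derive (is_derive := phis p p01)))) in E1.
rewrite (derive_val (is_derive := phis p p01)) in E1.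
have fuvs q : 0 <= q <= 1 -> derivable ('D_u f) (q *: (s *: v) + (p *: (s *: u) + x)) v.
  by move=> q01; apply: fuv; rewrite addrCA addrA; exact: smallA.
have [q q01|q q01 E2] := @mean_value_dir R V ('D_u f) (p *: (s *: u) + x) (s *: v).
  by have [] := is_derive_scaledir s (fuvs q q01).
rewrite (derive_val (is_derive := is_derive_scaledir s (fuvs q q01))) in E2.
have -> : second_difference f x (s *: u) (s *: v) =
    s ^+ 2 * 'D_v ('D_u f) (p *: (s *: u) + q *: (s *: v) + x).
  rewrite /second_difference.
  transitivity (phi (s *: u + x) - phi x).
    by rewrite /phi (addrC x) (addrAC (s *: u) x); ring.
  have EA : q *: (s *: v) + (p *: (s *: u) + x) = p *: (s *: u) + q *: (s *: v) + x.
    by rewrite addrCA addrA.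
  rewrite EA (addrC (s *: v) (p *: (s *: u) + x)) in E2.
  by rewrite E1 E2 mulrA -expr2.
rewrite mulKf ?sqrf_eq0//.
by have [] := rP _ (small p q p01 q01).
Unshelve. all: by end_near. Qed.

(** The second difference is symmetric in [u] and [v], so both iterated derivatives
    are limits of the same quotient. *)
Lemma derive_comm (A : set V) f x u v :
  open A -> A x ->
  (forall y, A y -> derivable f y u) -> (forall y, A y -> derivable f y v) ->
  (forall y, A y -> derivable ('D_u f) y v) ->
  (forall y, A y -> derivable ('D_v f) y u) ->
  {for x, continuous ('D_v ('D_u f))} -> {for x, continuous ('D_u ('D_v f))} ->
  'D_v ('D_u f) x = 'D_u ('D_v f) x.
Proof.
move=> oA Ax fu fv fuv fvu cuv cvu.
have H1 := second_difference_cvg oA Ax fu fuv cuv.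
have H2 := second_difference_cvg oA Ax fv fvu cvu.
have E : (fun s : R => (s ^+ 2)^-1 * second_difference f x (s *: u) (s *: v))
  = (fun s : R => (s ^+ 2)^-1 * second_difference f x (s *: v) (s *: u)).
  apply/funext => s; congr (_ * _); rewrite /second_difference (addrC (s *: u)).
  by rewrite [X in X + _ = _]addrAC.
rewrite E in H1; exact: (cvg_unique _ H1 H2).
Qed.

End Schwarz.

(** * Closure properties of smooth maps *)

Section Ck.
Context (R : realType).

Lemma Ck_sub n (E : normedModType R) k (A B : set 'rV[R]_n) (f : 'rV[R]_n -> E) :
  B `<=` A -> Ck_on k A f -> Ck_on k B f.
Proof.
move=> BA; elim: k f => [|k IH] f [fc H]; (split; first by move=> x /BA /fc) => // v.
by have [dv cv] := H v; split; [move=> x /BA /dv|exact: IH].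
Qed.

Lemma Ck_pred n (E : normedModType R) k (A : set 'rV[R]_n) (f : 'rV[R]_n -> E) :
  Ck_on k.+1 A f -> Ck_on k A f.
Proof.
elim: k f => [|k IH] f [fc H]; split => // v.
by have [dv cv] := H v; split; [exact: dv|exact: IH].
Qed.

Lemma open_near_eq n (T : Type) (A : set 'rV[R]_n) (f g : 'rV[R]_n -> T) x :
  open A -> A x -> (forall y, A y -> f y = g y) -> \forall y \near x, f y = g y.
Proof.
move=> oA Ax fg; apply: (filterS (P := A)) => //; exact: open_nbhs_nbhs.
Qed.

Lemma eq_open_derive n (E : normedModType R) (A : set 'rV[R]_n)
    (f g : 'rV[R]_n -> E) x v : open A -> A x ->
  (forall y, A y -> f y = g y) -> 'D_v f x = 'D_v g x.
Proof. by move=> oA Ax fg; apply/near_eq_derive/(open_near_eq oA Ax fg). Qed.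

Lemma Ck_ext n (E : normedModType R) k (A : set 'rV[R]_n) (f g : 'rV[R]_n -> E) :
  open A -> (forall x, A x -> f x = g x) -> Ck_on k A f -> Ck_on k A g.
Proof.
move=> oA; have cont (f' g' : 'rV[R]_n -> E) : (forall x, A x -> f' x = g' x) ->
    (forall x, A x -> {for x, continuous f'}) -> forall x, A x -> {for x, continuous g'}.
  move=> fg fc x Ax; rewrite /prop_for /continuous_at -(fg x Ax).
  move=> P nP; have H1 := fc x Ax P nP.
  have H2 : nbhs x A by exact: open_nbhs_nbhs.
  have := @filterI _ _ (nbhs_filter x) _ _ H2 H1.
  by apply: (@filterS _ _ (nbhs_filter x)) => y [Ay]; rewrite /= (fg y Ay).
elim: k f g => [|k IH] f g fg [fc H]; (split; first exact: cont fc) => // v.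
have [dv cv] := H v; split.
  move=> x Ax; apply: near_eq_derivable (dv x Ax).
  exact: (open_near_eq oA Ax fg).
by apply: IH cv => x Ax; exact: eq_open_derive fg.
Qed.

(** The form in which regularity is established: it suffices to exhibit the
    derivatives, instead of reasoning on the limits that define them. *)
Lemma CkS n (E : normedModType R) k (A : set 'rV[R]_n) (f : 'rV[R]_n -> E)
    (G : 'rV[R]_n -> 'rV[R]_n -> E) : open A ->
  (forall x, A x -> {for x, continuous f}) ->
  (forall v x, A x -> is_derive x v f (G v x)) ->
  (forall v, Ck_on k A (G v)) -> Ck_on k.+1 A f.
Proof.
move=> oA fc fG GC; split => // v; split.
  by move=> x Ax; have [] := fG v x Ax.
refine (Ck_ext oA _ (GC v)) => x Ax; by have [_ ->] := fG v x Ax.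
Qed.

Lemma Ck_derivable n (E : normedModType R) k (A : set 'rV[R]_n)
  (f : 'rV[R]_n -> E) v x : Ck_on k.+1 A f -> A x -> derivable f x v.
Proof. by move=> [_ H] Ax; have [/(_ x Ax)] := H v. Qed.

Lemma Ck_derive n (E : normedModType R) k (A : set 'rV[R]_n)
  (f : 'rV[R]_n -> E) v : Ck_on k.+1 A f -> Ck_on k A ('D_v f).
Proof. by move=> [_ H]; have [] := H v. Qed.

Lemma Ck_continuous n (E : normedModType R) k (A : set 'rV[R]_n)
  (f : 'rV[R]_n -> E) x : Ck_on k A f -> A x -> {for x, continuous f}.
Proof. by case: k => [|k] [fc _]; exact: fc. Qed.

Section RealValued.
Context (n : nat) (A : set 'rV[R]_n) (oA : open A).
Implicit Types f g : 'rV[R]_n -> R.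

Lemma Ck_cst (E : normedModType R) k (c : E) : Ck_on k A (cst c).
Proof.
elim: k c => [|k IH] c; first by split => // x _; exact: cst_continuous.
refine (CkS (G := fun=> cst 0) oA _ _ _) => [x _|v].
- exact: cst_continuous.
- exact: IH.
Qed.

Lemma CkD (E : normedModType R) k (f g : 'rV[R]_n -> E) : Ck_on k A f -> Ck_on k A g ->
  Ck_on k A (fun x => f x + g x).
Proof.
elim: k f g => [|k IH] f g fC gC.
  split => // x Ax; exact: (continuousD (Ck_continuous fC Ax) (Ck_continuous gC Ax)).
refine (CkS (G := fun v x => 'D_v f x + 'D_v g x) oA _ _ _) => [x Ax|v x Ax|v].
- exact: (continuousD (Ck_continuous fC Ax) (Ck_continuous gC Ax)).
- apply: is_deriveD; apply: derivableP; [exact: (Ck_derivable fC Ax)|exact: (Ck_derivable gC Ax)].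
- by apply: IH; exact: Ck_derive.
Qed.

Lemma CkM k f g : Ck_on k A f -> Ck_on k A g -> Ck_on k A (fun x => f x * g x).
Proof.
elim: k f g => [|k IH] f g fC gC.
  split => // x Ax; exact: (continuousM (Ck_continuous fC Ax) (Ck_continuous gC Ax)).
refine (CkS (G := fun v x => f x * 'D_v g x + g x * 'D_v f x) oA _ _ _) => [x Ax|v x Ax|v].
- exact: (continuousM (Ck_continuous fC Ax) (Ck_continuous gC Ax)).
- apply: is_deriveM; apply: derivableP; [exact: (Ck_derivable fC Ax)|exact: (Ck_derivable gC Ax)].
- by apply: CkD; apply: IH; do ?[exact: Ck_derive|exact: Ck_pred].
Qed.

Lemma CkN k f : Ck_on k A f -> Ck_on k A (fun x => - f x).
Proof.
move=> fC; refine (Ck_ext oA _ (CkM (Ck_cst k (-1 : R)) fC)) => x _; exact: mulN1r.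
Qed.

Lemma CkB k f g : Ck_on k A f -> Ck_on k A g -> Ck_on k A (fun x => f x - g x).
Proof. by move=> fC gC; apply: CkD fC (CkN gC). Qed.

Lemma Ck_sum (E : normedModType R) k m (f : 'I_m -> 'rV[R]_n -> E) :
  (forall i, Ck_on k A (f i)) -> Ck_on k A (fun x => \sum_i f i x).
Proof.
elim: m f => [|m IH] f fC.
  by refine (Ck_ext oA _ (Ck_cst k (0 : E))) => x _; rewrite big_ord0.
refine (Ck_ext oA _ (CkD (IH _ (fun i => fC (widen_ord (leqnSn m) i))) (fC ord_max))) => x _.
by rewrite big_ord_recr.
Qed.

(** The derivative of the inverse is a polynomial in the inverse itself and in the
    derivative of [f], hence the induction on [k] closes.  The square root is
    treated in the same way. *)
Lemma CkV k f : (forall x, A x -> f x != 0) -> Ck_on k A f ->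
  Ck_on k A (fun x => (f x)^-1).
Proof.
move=> f0; elim: k => [|k IH] fC.
  by split => // x Ax; apply: continuousV; [exact: f0|exact: (Ck_continuous fC Ax)].
have fV := IH (Ck_pred fC).
refine (CkS (G := fun v x => - ((f x)^-1 * (f x)^-1 * 'D_v f x)) oA _ _ _) => [x Ax|v x Ax|v].
- by apply: continuousV; [exact: f0|exact: (Ck_continuous fC Ax)].
- have fd := @Ck_derivable _ _ _ _ _ v x fC Ax.
  split; first exact: (derivableV (f0 x Ax) fd).
  rewrite (deriveV (f0 x Ax) fd) -[LHS]/(_ * _) mulNr; congr (- (_ * _)).
  by rewrite expr2 invfM.
- by apply: CkN; apply: CkM; [exact: CkM|exact: Ck_derive].
Qed.

Lemma is_derive_comp_real (h : R -> R) f v x (dh : R) : derivable f x v ->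
  is_derive (f x) 1 h dh -> is_derive x v (h \o f) (dh * 'D_v f x).
Proof.
move=> fd hd.
have d1 := is_derive_line0 fd.
have f0 : f (0 *: v + x) = f x by rewrite scale0r add0r.
rewrite -f0 in hd.
have d3 := is_derive1_comp hd d1.
have hfd : derivable (h \o f) x v by apply/derivable1P; case: d3.
split => //.
have [_ <-] := is_derive_line0 hfd.
by case: d3.
Qed.

Lemma Ck_sqrt k f : (forall x, A x -> 0 < f x) -> Ck_on k A f ->
  Ck_on k A (fun x => Num.sqrt (f x)).
Proof.
move=> f0.
have cont j x : Ck_on j A f -> A x -> {for x, continuous (fun x => Num.sqrt (f x))}.
  move=> fC Ax; apply: (@continuous_comp _ _ _ f Num.sqrt).
    exact: (Ck_continuous fC Ax).
  exact: sqrt_continuous.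
elim: k => [|k IH] fC; first by split => // x; exact: cont fC.
have fS := IH (Ck_pred fC).
refine (CkS (G := fun v x => (2 * Num.sqrt (f x))^-1 * 'D_v f x) oA _ _ _) => [x Ax|v x Ax|v].
- exact: cont fC Ax.
- apply: (@is_derive_comp_real Num.sqrt) => //; first exact: (Ck_derivable fC Ax).
  exact/is_derive1_sqrt/f0.
- apply: CkM; last exact: Ck_derive.
  apply: CkV; last by apply: CkM => //; exact: Ck_cst.
  by move=> x /f0 fx0; rewrite mulf_neq0// gt_eqF// sqrtr_gt0.
Qed.

Lemma Ck_acos k f : (forall x, A x -> -1 < f x < 1) -> Ck_on k A f ->
  Ck_on k A (fun x => acos (f x)).
Proof.
move=> f1; have cont j x : Ck_on j A f -> A x -> {for x, continuous (fun x => acos (f x))}.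
  move=> fC Ax; apply: (@continuous_comp _ _ _ f (@acos R)); first exact: (Ck_continuous fC Ax).
  apply/differentiable_continuous/derivable1_diffP.
  by have [] := is_derive1_acos (f1 x Ax).
case: k => [|k] fC; first by split => // x; exact: cont fC.
refine (CkS (G := fun v x => - (Num.sqrt (1 - f x ^+ 2))^-1 * 'D_v f x) oA _ _ _) => [x|v x Ax|v].
- exact: cont fC.
- apply: (@is_derive_comp_real (@acos R)) => //; first exact: (Ck_derivable fC Ax).
  exact/is_derive1_acos/f1.
- have pos x : A x -> 0 < 1 - f x ^+ 2.
    by move=> /f1/andP[? ?]; nra.
  apply: CkM; last exact: Ck_derive.
  apply: CkN; apply: CkV => [x /pos|]; first by rewrite -sqrtr_gt0 => /gt_eqF->.
  apply: Ck_sqrt => //; apply: CkB; first exact: Ck_cst.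
  by apply: CkM; exact: Ck_pred.
Qed.

End RealValued.
End Ck.

(** * Chain rule and composition in several variables *)

Section Rows.
Context (R : realType).

Lemma row_continuous (T : topologicalType) m (F : T -> 'rV[R]_m) x :
  (forall j, {for x, continuous (fun y => F y 0 j)}) -> {for x, continuous F}.
Proof.
move=> Fc; apply/cvgrPdist_le => eps eps0.
have H (j : 'I_m) : \forall y \near x, `|F x 0 j - F y 0 j| <= eps.
  by have /cvgrPdist_le/(_ _ eps0) := Fc j.
have := @filter_forall _ _ _ _ (nbhs_filter x) H.
apply: (@filterS _ _ (nbhs_filter x)) => y Hy.
apply: norm_row_le => [|j]; first exact: ltW.
by rewrite !mxE; exact: Hy.
Qed.

Lemma continuous_coord (T : topologicalType) m (F : T -> 'rV[R]_m) x j :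
  {for x, continuous F} -> {for x, continuous (fun y => F y 0 j)}.
Proof.
move=> Fc; apply: (@continuous_comp _ _ _ F (fun v : 'rV[R]_m => v 0 j)) => //.
exact: coord_continuous.
Qed.

Lemma is_derive_coord (V : normedModType R) m (F : V -> 'rV[R]_m) x v dF j :
  is_derive x v F dF -> is_derive x v (fun y => F y 0 j) (dF 0 j).
Proof.
move=> [Fd <-]; split; first by have /derivable_mxP := Fd; exact.
by rewrite derive_mx// mxE.
Qed.

Lemma is_derive_row (V : normedModType R) m (F : V -> 'rV[R]_m) x v
    (dF : 'rV[R]_m) :
  (forall j, is_derive x v (fun y => F y 0 j) (dF 0 j)) -> is_derive x v F dF.
Proof.
move=> Fd; have FD : derivable F x v.
  by apply/derivable_mxP => i j; rewrite ord1; case: (Fd j).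
split => //; rewrite derive_mx//; apply/rowP => j; rewrite mxE.
by case: (Fd j).
Qed.

Lemma Ck_coord n m k (A : set 'rV[R]_n) (F : 'rV[R]_n -> 'rV[R]_m) j :
  open A -> Ck_on k A F -> Ck_on k A (fun x => F x 0 j).
Proof.
move=> oA; elim: k F => [|k IH] F FC.
  by split => // x Ax; exact: continuous_coord (Ck_continuous FC Ax).
refine (CkS (G := fun v x => 'D_v F x 0 j) oA _ _ _) => [x Ax|v x Ax|v].
- exact: continuous_coord (Ck_continuous FC Ax).
- exact: is_derive_coord (derivableP (Ck_derivable FC Ax)).
- exact/IH/Ck_derive.
Qed.

Lemma Ck_row n m k (A : set 'rV[R]_n) (F : 'rV[R]_n -> 'rV[R]_m) :
  open A -> (forall j, Ck_on k A (fun x => F x 0 j)) -> Ck_on k A F.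
Proof.
move=> oA; elim: k F => [|k IH] F FC.
  by split => // x Ax; apply: row_continuous => j; exact: (Ck_continuous (FC j) Ax).
refine (CkS (G := fun v x => \row_j 'D_v (fun y => F y 0 j) x) oA _ _ _) => [x Ax|v x Ax|v].
- by apply: row_continuous => j; exact: (Ck_continuous (FC j) Ax).
- apply: is_derive_row => j; rewrite mxE; apply: derivableP.
  exact: (Ck_derivable (FC j) Ax).
- apply: IH => j.
  have -> : (fun x => (\row_j 'D_v (fun y => F y 0 j) x) 0 j) = 'D_v (fun y => F y 0 j).
    by apply/funext => x; rewrite mxE.
  exact: Ck_derive.
Qed.

Lemma Ck1_differentiable n (A : set 'rV[R]_n) (f : 'rV[R]_n -> R) x :
  open A -> A x -> Ck_on 1 A f -> differentiable f x.
Proof.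
move=> oA Ax fC; apply: (C1_differentiable oA Ax) => [i y Ay|i].
  exact: (Ck_derivable fC Ay).
exact: (Ck_continuous (Ck_derive _ fC) Ax).
Qed.

Lemma Ck1_row_differentiable n m (A : set 'rV[R]_n) (F : 'rV[R]_n -> 'rV[R]_m) x :
  open A -> A x -> Ck_on 1 A F -> differentiable F x.
Proof.
move=> oA Ax FC.
have -> : F = \sum_(j < m) (fun y => F y 0 j *: delta_mx 0 j).
  apply/funext => y; rewrite fct_sumE; exact: row_sum_delta.
apply: differentiable_sum => j; apply: differentiableZl.
exact: (Ck1_differentiable oA Ax (Ck_coord j oA FC)).
Qed.

Lemma derive_dirD (V W : normedModType R) (f : V -> W) x u v :
  differentiable f x -> 'D_(u + v) f x = 'D_u f x + 'D_v f x.
Proof. by move=> fd; rewrite !deriveE// linearD. Qed.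

Lemma derive_dirB (V W : normedModType R) (f : V -> W) x u v :
  differentiable f x -> 'D_(u - v) f x = 'D_u f x - 'D_v f x.
Proof. by move=> fd; rewrite !deriveE// linearB. Qed.

Lemma derive_dirZ (V W : normedModType R) (f : V -> W) x c v :
  differentiable f x -> 'D_(c *: v) f x = c *: 'D_v f x.
Proof. by move=> fd; rewrite !deriveE// linearZ. Qed.

Lemma derive_dir_sum n (W : normedModType R) (f : 'rV[R]_n -> W) x v :
  differentiable f x -> 'D_v f x = \sum_i v 0 i *: 'D_(delta_mx 0 i) f x.
Proof.
move=> fd; rewrite [X in 'D_X _ _]row_sum_delta deriveE// linear_sum.
by apply: eq_bigr => i _; rewrite linearZ/= deriveE.
Qed.

Lemma derive_chain (U V W : normedModType R) (g : U -> V) (f : V -> W) x v :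
  differentiable g x -> differentiable f (g x) ->
  'D_v (f \o g) x = 'D_('D_v g x) f (g x).
Proof.
move=> gd fd; rewrite deriveE; last exact: differentiable_comp.
by rewrite diff_comp //= (deriveE _ gd) (deriveE _ fd).
Qed.

(** By the chain rule the derivative of [f \o g] is a sum of products of coordinates
    of a derivative of [g] and of partial derivatives of [f] composed with [g]; all
    have one order less. *)
Lemma Ck_comp n m k (A : set 'rV[R]_m) (B : set 'rV[R]_n)
    (f : 'rV[R]_m -> R) (g : 'rV[R]_n -> 'rV[R]_m) :
  open A -> open B -> (forall x, B x -> A (g x)) ->
  Ck_on k A f -> Ck_on k B g -> Ck_on k B (f \o g).
Proof.
move=> oA oB gBA; have cont f' x : {for g x, continuous f'} -> {for x, continuous g} ->
    {for x, continuous (f' \o g : _ -> R)}.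
  by move=> ? ?; exact: continuous_comp.
elim: k f => [|k IH] f fC gC.
  by split => // x Bx; apply: cont; [exact: (Ck_continuous fC (gBA x Bx))|exact: (Ck_continuous gC Bx)].
refine (CkS (G := fun v x => \sum_i 'D_v g x 0 i * ('D_(delta_mx 0 i) f \o g) x) oB _ _ _) => [x Bx|v x Bx|v].
- by apply: cont; [exact: (Ck_continuous fC (gBA x Bx))|exact: (Ck_continuous gC Bx)].
- have C1 j (E : normedModType R) p (D : set 'rV[R]_p) (h : _ -> E) : Ck_on j.+1 D h -> Ck_on 1 D h.
    by elim: j => // j IHj /Ck_pred.
  have gd := Ck1_row_differentiable oB Bx (C1 _ _ _ _ _ gC).
  have fd := Ck1_differentiable oA (gBA x Bx) (C1 _ _ _ _ _ fC).
  split; first exact: diff_derivable (differentiable_comp gd fd).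
  by rewrite (derive_chain _ gd fd) (derive_dir_sum _ fd).
- apply: Ck_sum => // i; apply: CkM => //.
    exact/(Ck_coord i oB)/Ck_derive.
  by apply: IH; [exact: Ck_derive|exact: Ck_pred].
Qed.

End Rows.

(** * Smooth maps on an open set *)

Section SmoothOn.
Context (R : realType) (n : nat) (A : set 'rV[R]_n) (oA : open A).
Implicit Types f g : 'rV[R]_n -> R.

Lemma smooth_cst (E : normedModType R) (c : E) : smooth_on A (fun=> c).
Proof. move=> k; exact: Ck_cst. Qed.

Lemma smooth_ext (E : normedModType R) (f g : 'rV[R]_n -> E) :
  (forall x, A x -> f x = g x) -> smooth_on A f -> smooth_on A g.
Proof. by move=> fg fC k; exact: Ck_ext (fC k). Qed.

Lemma smooth_sub (E : normedModType R) (B : set 'rV[R]_n) (f : 'rV[R]_n -> E) :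
  B `<=` A -> smooth_on A f -> smooth_on B f.
Proof. by move=> BA fC k; exact: Ck_sub (fC k). Qed.

Lemma smoothD (E : normedModType R) (f g : 'rV[R]_n -> E) :
  smooth_on A f -> smooth_on A g -> smooth_on A (fun x => f x + g x).
Proof. by move=> fC gC k; exact: CkD. Qed.

Lemma smoothM f g : smooth_on A f -> smooth_on A g -> smooth_on A (fun x => f x * g x).
Proof. by move=> fC gC k; exact: CkM. Qed.

Lemma smooth_sum (E : normedModType R) m (f : 'I_m -> 'rV[R]_n -> E) :
  (forall i, smooth_on A (f i)) -> smooth_on A (fun x => \sum_i f i x).
Proof. by move=> fC k; apply: Ck_sum => // i; exact: fC. Qed.

Lemma smoothV f : (forall x, A x -> f x != 0) -> smooth_on A f ->
  smooth_on A (fun x => (f x)^-1).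
Proof. by move=> f0 fC k; exact: CkV. Qed.

Lemma smooth_sqrt f : (forall x, A x -> 0 < f x) -> smooth_on A f ->
  smooth_on A (fun x => Num.sqrt (f x)).
Proof. by move=> f0 fC k; exact: Ck_sqrt. Qed.

Lemma smooth_acos f : (forall x, A x -> -1 < f x < 1) -> smooth_on A f ->
  smooth_on A (fun x => acos (f x)).
Proof. by move=> f1 fC k; exact: Ck_acos. Qed.

Lemma smooth_coord m (F : 'rV[R]_n -> 'rV[R]_m) j :
  smooth_on A F -> smooth_on A (fun x => F x 0 j).
Proof. by move=> FC k; exact: Ck_coord. Qed.

Lemma smooth_row m (F : 'rV[R]_n -> 'rV[R]_m) :
  (forall j, smooth_on A (fun x => F x 0 j)) -> smooth_on A F.
Proof. by move=> FC k; apply: Ck_row => // j; exact: FC. Qed.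

Lemma smoothZ m f (F : 'rV[R]_n -> 'rV[R]_m) :
  smooth_on A f -> smooth_on A F -> smooth_on A (fun x => f x *: F x).
Proof.
move=> fC FC; apply: smooth_row => j.
have -> : (fun x => (f x *: F x) 0 j) = (fun x => f x * F x 0 j).
  by apply/funext => x; rewrite mxE.
by apply: smoothM => //; exact: smooth_coord.
Qed.

Lemma smooth_derive (E : normedModType R) (f : 'rV[R]_n -> E) v :
  smooth_on A f -> smooth_on A ('D_v f).
Proof. by move=> fC k; exact: Ck_derive. Qed.

Lemma smooth_differentiable f x : A x -> smooth_on A f -> differentiable f x.
Proof. by move=> Ax fC; exact: Ck1_differentiable (fC 1%N). Qed.

Lemma smooth_row_differentiable m (F : 'rV[R]_n -> 'rV[R]_m) x :
  A x -> smooth_on A F -> differentiable F x.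
Proof. by move=> Ax fC; exact: Ck1_row_differentiable (fC 1%N). Qed.

Lemma smooth_continuous (E : normedModType R) (f : 'rV[R]_n -> E) x :
  A x -> smooth_on A f -> {for x, continuous f}.
Proof. by move=> Ax fC; exact: Ck_continuous (fC 0%N) Ax. Qed.

Lemma smooth_derive_comm f x u v : A x -> smooth_on A f ->
  'D_v ('D_u f) x = 'D_u ('D_v f) x.
Proof.
move=> Ax fC; have H w : smooth_on A ('D_w f) by exact: smooth_derive.
apply: (derive_comm oA Ax) => [y Ay|y Ay|y Ay|y Ay||].
- exact: (Ck_derivable (fC 1%N) Ay).
- exact: (Ck_derivable (fC 1%N) Ay).
- exact: (Ck_derivable (H _ 1%N) Ay).
- exact: (Ck_derivable (H _ 1%N) Ay).
- exact/(smooth_continuous Ax)/smooth_derive.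
- exact/(smooth_continuous Ax)/smooth_derive.
Qed.

Lemma smooth_comp m (B : set 'rV[R]_m) (f : 'rV[R]_m -> R) (g : 'rV[R]_n -> 'rV[R]_m) :
  open B -> (forall x, A x -> B (g x)) ->
  smooth_on B f -> smooth_on A g -> smooth_on A (f \o g).
Proof. by move=> oB gB fC gC k; exact: (Ck_comp oB oA gB). Qed.

Lemma smooth_row_comp m p (B : set 'rV[R]_m) (f : 'rV[R]_m -> 'rV[R]_p) (g : 'rV[R]_n -> 'rV[R]_m) :
  open B -> (forall x, A x -> B (g x)) ->
  smooth_on B f -> smooth_on A g -> smooth_on A (f \o g).
Proof.
move=> oB gB fC gC; apply: smooth_row => j.
by refine (smooth_comp (f := fun y => f y 0 j) oB gB _ gC) => k; exact: Ck_coord.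
Qed.

End SmoothOn.

(** * Charts and coordinate changes *)

Section Charts.
Context (R : realType) (n : nat) (M : smooth_manifold R n).
Implicit Types (c d : chart M) (p q : M) (W : set M) (v w : 'rV[R]_n).

Definition chart_image c W : set 'rV[R]_n := chart_map c @` (chart_dom c `&` W).

Lemma chart_imageP c W x : chart_image c W x ->
  [/\ chart_dom c (chart_inv c x), W (chart_inv c x) &
      chart_map c (chart_inv c x) = x].
Proof. by move=> [q [cq Wq] <-]; rewrite chart_mapK. Qed.

Lemma mem_chart_image c W p : chart_dom c p -> W p -> chart_image c W (chart_map c p).
Proof. by move=> cp Wp; exists p. Qed.

Lemma chart_image_sub c W W' : W `<=` W' -> chart_image c W `<=` chart_image c W'.
Proof. by move=> WW x [q [cq Wq] <-]; exists q => //; split => //; exact: WW. Qed.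

Lemma open_chart_image c W : open W -> open (chart_image c W).
Proof.
move=> oW; rewrite openE => _ [p [cp Wp] <-]; rewrite /interior.
have px : (chart_map c @` chart_dom c) (chart_map c p) by exists p.
have H1 : nbhs (chart_map c p) (chart_map c @` chart_dom c).
  by apply: open_nbhs_nbhs; split => //; exact: chart_img_open.
have H2 := chart_inv_continuous px.
have nW : nbhs (chart_inv c (chart_map c p)) W.
  by rewrite chart_mapK//; exact: open_nbhs_nbhs.
have := @filterI _ _ (nbhs_filter _) _ _ H1 (H2 W nW).
apply: (@filterS _ _ (nbhs_filter _)) => _ [[q cq <-]] /=; rewrite chart_mapK// => Wq.
by exists q.
Qed.

Definition transition c d := chart_map d \o chart_inv c.

Lemma smooth_transition c d W : W `<=` chart_dom d ->
  smooth_on (chart_image c W) (transition c d).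
Proof.
by move=> Wd; apply: smooth_sub (transition_smooth c d); exact: chart_image_sub.
Qed.

Lemma transition_differentiable c d p : chart_dom c p -> chart_dom d p ->
  differentiable (transition c d) (chart_map c p).
Proof.
move=> cp dp; apply: (@smooth_row_differentiable _ _ (chart_image c (chart_dom d))).
- exact/open_chart_image/chart_dom_open.
- exact: mem_chart_image.
- exact: smooth_transition.
Qed.

Lemma derive_transition_id c p v : chart_dom c p ->
  'D_v (transition c c) (chart_map c p) = v.
Proof.
move=> cp; rewrite (@eq_open_derive _ _ _ (chart_image c (chart_dom c)) _ id).
- exact: derive_id.
- exact/open_chart_image/chart_dom_open.
- exact: mem_chart_image.
- by move=> x /chart_imageP[].
Qed.

(** The coordinate change formula for a directional derivative.  With [f] a chart
    it says that tangent vectors transform by the differential of the transition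
    map, with [f] a function that its derivative can be computed in any chart. *)
Lemma derive_transition_chain (E : normedModType R) c d p v (f : M -> E) :
  chart_dom c p -> chart_dom d p ->
  differentiable (f \o chart_inv d) (chart_map d p) ->
  'D_v (f \o chart_inv c) (chart_map c p) =
  'D_('D_v (transition c d) (chart_map c p)) (f \o chart_inv d) (chart_map d p).
Proof.
move=> cp dp fd.
have tE : transition c d (chart_map c p) = chart_map d p.
  by rewrite /transition/= chart_mapK.
rewrite -tE -derive_chain; last by rewrite tE.
- apply: (@eq_open_derive _ _ _ (chart_image c (chart_dom d))).
  + exact/open_chart_image/chart_dom_open.
  + exact: mem_chart_image.
  + by move=> x /chart_imageP[_ dx _]; rewrite /transition/= (chart_mapK dx).
- exact: transition_differentiable.
Qed.

Lemma tcompD c p v w : chart_dom c p -> tcomp c p (v + w) = tcomp c p v + tcomp c p w.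
Proof.
move=> cp; apply: derive_dirD; apply: transition_differentiable => //; exact: chart_atP.
Qed.

Lemma tcompZ c p (a : R) v : chart_dom c p -> tcomp c p (a *: v) = a *: tcomp c p v.
Proof.
move=> cp; apply: derive_dirZ; apply: transition_differentiable => //; exact: chart_atP.
Qed.

Lemma tcomp_id p v : tcomp (chart_at p) p v = v.
Proof. exact/derive_transition_id/chart_atP. Qed.

End Charts.

(** * Smooth functions and vector fields on a manifold *)

Section SmoothFunctions.
Context (R : realType) (n : nat) (M : smooth_manifold R n).
Implicit Types (c d : chart M) (p q : M) (W : set M) (f g : M -> R) (X Y : vfield M).

Lemma smooth_fun_sub W W' f : W' `<=` W -> smooth_fun W f -> smooth_fun W' f.
Proof. move=> WW fS c; apply: smooth_sub (fS c); exact: chart_image_sub. Qed.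

Lemma smooth_vfield_sub W W' X : W' `<=` W -> smooth_vfield W X -> smooth_vfield W' X.
Proof. move=> WW fS c; apply: smooth_sub (fS c); exact: chart_image_sub. Qed.

Lemma smooth_fun_ext W f g : open W -> (forall p, W p -> f p = g p) ->
  smooth_fun W f -> smooth_fun W g.
Proof.
move=> oW fg fS c; refine (smooth_ext (open_chart_image (c := c) oW) _ (fS c)) => x.
by move=> /chart_imageP[_ Wx _] /=; rewrite fg.
Qed.

Lemma smooth_vfield_ext W X Y : open W -> (forall p, W p -> X p = Y p) ->
  smooth_vfield W X -> smooth_vfield W Y.
Proof.
move=> oW XY XS c; refine (smooth_ext (open_chart_image (c := c) oW) _ (XS c)) => x.
by move=> /chart_imageP[_ Wx _]; rewrite /field_comp XY.
Qed.

Lemma smooth_fun_cst W (a : R) : open W -> smooth_fun W (fun=> a).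
Proof. by move=> oW c; exact: (smooth_cst (open_chart_image (c := c) oW) a). Qed.

Lemma smooth_funM W f g : open W -> smooth_fun W f -> smooth_fun W g ->
  smooth_fun W (fun p => f p * g p).
Proof. by move=> oW fS gS c; exact: (smoothM (open_chart_image (c := c) oW) (fS c) (gS c)). Qed.

Lemma smooth_fun_sum W m (f : 'I_m -> M -> R) : open W ->
  (forall i, smooth_fun W (f i)) -> smooth_fun W (fun p => \sum_i f i p).
Proof.
by move=> oW fS c; exact: (smooth_sum (open_chart_image (c := c) oW) (fun i => fS i c)).
Qed.

Lemma smooth_funV W f : open W -> (forall p, W p -> f p != 0) -> smooth_fun W f ->
  smooth_fun W (fun p => (f p)^-1).
Proof.
move=> oW f0 fS c; refine (smoothV (open_chart_image (c := c) oW) _ (fS c)) => x.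
by move=> /chart_imageP[_ Wx _]; exact: f0.
Qed.

Lemma smooth_fun_sqrt W f : open W -> (forall p, W p -> 0 < f p) -> smooth_fun W f ->
  smooth_fun W (fun p => Num.sqrt (f p)).
Proof.
move=> oW f0 fS c; refine (smooth_sqrt (open_chart_image (c := c) oW) _ (fS c)) => x.
by move=> /chart_imageP[_ Wx _]; exact: f0.
Qed.

Lemma smooth_fun_acos W f : open W -> (forall p, W p -> -1 < f p < 1) -> smooth_fun W f ->
  smooth_fun W (fun p => acos (f p)).
Proof.
move=> oW f0 fS c; refine (smooth_acos (open_chart_image (c := c) oW) _ (fS c)) => x.
by move=> /chart_imageP[_ Wx _]; exact: f0.
Qed.

Lemma smooth_fun_continuous W f p : open W -> W p -> smooth_fun W f ->
  {for p, continuous f}.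
Proof.
move=> oW Wp fS; set c := chart_at p; have cp : chart_dom c p by exact: chart_atP.
have fc : {for chart_map c p, continuous (f \o chart_inv c)}.
  exact: (smooth_continuous (mem_chart_image cp Wp) (fS c)).
have H : {for p, continuous ((f \o chart_inv c) \o chart_map c)}.
  by apply: continuous_comp fc; exact: chart_map_continuous.
move=> P; rewrite -{1}(chart_mapK cp) => nP.
have H1 := H P nP.
have H2 : nbhs p (chart_dom c).
  by apply: open_nbhs_nbhs; split => //; exact: chart_dom_open.
have := @filterI _ _ (nbhs_filter _) _ _ H2 H1.
by apply: (@filterS _ _ (nbhs_filter _)) => q [cq] /=; rewrite chart_mapK.
Qed.

Lemma open_smooth_neq0 W f : open W -> smooth_fun W f ->
  open (W `&` [set p | f p != 0]).
Proof.
move=> oW fS; rewrite openE => p [Wp /= fp]; apply: filterI.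
  exact: open_nbhs_nbhs.
have fc := smooth_fun_continuous oW Wp fS.
apply: (fc [set y | y != 0]); apply: open_nbhs_nbhs; split => //; exact: open_neq.
Qed.

Lemma smooth_vfieldD W X Y : open W -> smooth_vfield W X -> smooth_vfield W Y ->
  smooth_vfield W (fun p => X p + Y p).
Proof.
move=> oW XS YS c.
refine (smooth_ext (open_chart_image (c := c) oW) _ (smoothD (open_chart_image (c := c) oW) (XS c) (YS c))) => x.
by move=> /chart_imageP[cx Wx _]; rewrite /field_comp tcompD.
Qed.

Lemma smooth_vfieldZ W f X : open W -> smooth_fun W f -> smooth_vfield W X ->
  smooth_vfield W (fun p => f p *: X p).
Proof.
move=> oW fS XS c.
refine (smooth_ext (open_chart_image (c := c) oW) _ (smoothZ (open_chart_image (c := c) oW) (fS c) (XS c))) => x.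
by move=> /chart_imageP[cx Wx _]; rewrite /field_comp tcompZ.
Qed.

Lemma smooth_vfield0 W : open W -> smooth_vfield W (fun=> 0 : 'rV[R]_n).
Proof.
move=> oW c.
refine (smooth_ext (open_chart_image (c := c) oW) _ (smooth_cst (open_chart_image (c := c) oW) 0)) => x.
by move=> /chart_imageP[cx Wx _]; rewrite /field_comp -[X in tcomp _ _ X](scale0r 0) tcompZ// scale0r.
Qed.

Lemma smooth_vfield_sum W m (X : 'I_m -> vfield M) : open W ->
  (forall i, smooth_vfield W (X i)) -> smooth_vfield W (fun p => \sum_i X i p).
Proof.
move=> oW; elim: m X => [|m IH] X XS.
  by apply: smooth_vfield_ext (smooth_vfield0 oW) => // p _; rewrite big_ord0.
apply: smooth_vfield_ext (smooth_vfieldD oW (IH _ (fun i => XS (widen_ord (leqnSn m) i))) (XS ord_max)) => //.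
by move=> p _; rewrite big_ord_recr.
Qed.

Lemma smooth_vfieldB W X Y : open W -> smooth_vfield W X -> smooth_vfield W Y ->
  smooth_vfield W (fun p => X p - Y p).
Proof.
move=> oW XS YS.
apply: smooth_vfield_ext (smooth_vfieldD oW XS (smooth_vfieldZ oW (smooth_fun_cst (-1) oW) YS)) => //.
by move=> p _; rewrite scaleN1r.
Qed.

(** The field whose components in the chart [c] are constantly [v]: at [q] they are
    transported to the chart that coordinatizes the tangent space at [q]. *)
Definition pushed_field c (v : 'rV[R]_n) : vfield M := fun q =>
  'D_v (transition c (chart_at q)) (chart_map c q).

Lemma pushed_field_at c p v : c = chart_at p -> pushed_field c v p = v.
Proof. by move=> ->; exact/derive_transition_id/chart_atP. Qed.

(** In a chart [d] the components are the derivative along [v] of the transition from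
    [c] to [d], evaluated at a point that is itself the image of a transition.  This
    provides vector fields with a prescribed value at a point, the raw material for
    local frames. *)
Lemma smooth_pushed_field c v : smooth_vfield (chart_dom c) (pushed_field c v).
Proof.
move=> d; have oi : open (chart_image d (chart_dom c)).
  exact/open_chart_image/chart_dom_open.
have oi' : open (chart_image c (chart_dom d)).
  exact/open_chart_image/chart_dom_open.
have H : smooth_on (chart_image d (chart_dom c)) ('D_v (transition c d) \o transition d c).
  refine (smooth_row_comp oi oi' _ _ _).
  - move=> _ [q [dq cq] <-]; rewrite /transition/= chart_mapK//; exact: mem_chart_image.
  - exact/smooth_derive/smooth_transition.
  - exact: smooth_transition.
refine (smooth_ext oi _ H) => x /chart_imageP[dx cx xE] /=.
rewrite /field_comp /pushed_field; set q := chart_inv d x in dx cx xE *.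
change ('D_v (transition c d) (chart_map c q) =
  'D_('D_v (transition c (chart_at q)) (chart_map c q))
    (transition (chart_at q) d) (chart_map (chart_at q) q)).
apply: (derive_transition_chain _ (f := chart_map d)) => //.
- exact: chart_atP.
- apply: transition_differentiable => //; exact: chart_atP.
Qed.

End SmoothFunctions.

(** * Vector fields as derivations, the Lie bracket and the Jacobi identity *)

Section DirectionalDerivative.
Context (R : realType) (n : nat) (M : smooth_manifold R n).
Implicit Types (c d : chart M) (p q : M) (W : set M) (f g : M -> R) (X Y Z : vfield M).

Lemma smooth_fun_differentiable W f c p : open W -> W p -> chart_dom c p ->
  smooth_fun W f -> differentiable (f \o chart_inv c) (chart_map c p).
Proof.
move=> oW Wp cp fS.
exact: (smooth_differentiable (open_chart_image (c := c) oW) (mem_chart_image cp Wp) (fS c)).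
Qed.

Lemma dirder_chart W X f c p : open W -> W p -> chart_dom c p -> smooth_fun W f ->
  dirder X f p = 'D_(tcomp c p (X p)) (f \o chart_inv c) (chart_map c p).
Proof.
move=> oW Wp cp fS; apply: (derive_transition_chain _ (f := f)) => //.
  exact: chart_atP.
exact: smooth_fun_differentiable fS.
Qed.

Lemma dirder_at X f p : dirder (fun=> X p) f p = dirder X f p.
Proof. by rewrite /dirder. Qed.

Lemma dirder_ext W X f g p : open W -> W p -> (forall q, W q -> f q = g q) ->
  dirder X f p = dirder X g p.
Proof.
move=> oW Wp fg.
apply: (@eq_open_derive _ _ _ (chart_image (chart_at p) W)).
- exact: open_chart_image.
- by apply: mem_chart_image => //; exact: chart_atP.
- by move=> x /chart_imageP[_ Wx _] /=; exact: fg.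
Qed.

Lemma dirderD W X f g p : open W -> W p -> smooth_fun W f -> smooth_fun W g ->
  dirder X (fun q => f q + g q) p = dirder X f p + dirder X g p.
Proof.
move=> oW Wp fS gS; rewrite /dirder.
have cp := chart_atP p.
apply: (@deriveD _ _ _ (f \o chart_inv (chart_at p)) (g \o chart_inv (chart_at p)));
  by apply: diff_derivable; apply: smooth_fun_differentiable oW Wp cp _.
Qed.

Lemma dirderB W X f g p : open W -> W p -> smooth_fun W f -> smooth_fun W g ->
  dirder X (fun q => f q - g q) p = dirder X f p - dirder X g p.
Proof.
move=> oW Wp fS gS; rewrite /dirder.
have cp := chart_atP p.
apply: (@deriveB _ _ _ (f \o chart_inv (chart_at p)) (g \o chart_inv (chart_at p)));
  by apply: diff_derivable; apply: smooth_fun_differentiable oW Wp cp _.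
Qed.

Lemma dirder_chart_sum W X f c : open W -> smooth_fun W f ->
  forall x, chart_image c W x -> (dirder X f \o chart_inv c) x =
    \sum_i field_comp c X x 0 i * 'D_(delta_mx 0 i) (f \o chart_inv c) x.
Proof.
move=> oW fS x ix; have [cx Wx xE] := chart_imageP ix.
rewrite /= (dirder_chart X oW Wx cx fS) derive_dir_sum ?xE//.
exact: (smooth_differentiable (open_chart_image (c := c) oW) ix (fS c)).
Qed.

Lemma smooth_dirder W X f : open W -> smooth_vfield W X -> smooth_fun W f ->
  smooth_fun W (dirder X f).
Proof.
move=> oW XS fS c; have oi := open_chart_image (c := c) oW.
refine (smooth_ext oi (fun x ix => esym (dirder_chart_sum X oW fS ix)) _).
apply: (smooth_sum oi) => i; apply: (smoothM oi).
  exact: (smooth_coord oi i (XS c)).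
exact: (smooth_derive _ (fS c)).
Qed.

(** In coordinates the second derivatives of [f] enter both iterated derivatives and
    cancel by symmetry; what remains is the derivative of [f] along the
    coordinate expression of the bracket. *)
Lemma dirder_lie_bracket W X Y f p : open W -> W p ->
  smooth_vfield W X -> smooth_vfield W Y -> smooth_fun W f ->
  dirder (lie_bracket X Y) f p = dirder X (dirder Y f) p - dirder Y (dirder X f) p.
Proof.
move=> oW Wp XS YS fS; set c := chart_at p.
have cp : chart_dom c p by exact: chart_atP.
have oi := open_chart_image (c := c) oW; have ip := mem_chart_image cp Wp.
set x := chart_map c p in ip.
set F := f \o chart_inv c; have FS : smooth_on (chart_image c W) F := fS c.
have Fd w : differentiable ('D_w F) x.
  exact: (smooth_differentiable oi ip (smooth_derive w FS)).
have F'd : differentiable F x by exact: (smooth_differentiable oi ip FS).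
have key A B : smooth_vfield W A -> smooth_vfield W B ->
    dirder A (dirder B f) p = 'D_(A p) ('D_(B p) F) x + 'D_('D_(A p) (field_comp c B) x) F x.
  move=> AS BS; rewrite {1}/dirder -/c -/x.
  rewrite (@eq_open_derive _ _ _ (chart_image c W) _ _ _ _ oi ip (dirder_chart_sum B oW fS)).
  have Bd := smooth_row_differentiable oi ip (BS c).
  have BdA : is_derive x (A p) (field_comp c B) ('D_(A p) (field_comp c B) x).
    exact/derivableP/diff_derivable.
  have Bdi i : derivable (fun y => field_comp c B y 0 i) x (A p).
    by have [] := is_derive_coord i BdA.
  have -> : (fun y => \sum_i field_comp c B y 0 i * 'D_(delta_mx 0 i) F y) =
     \sum_i ((fun y => field_comp c B y 0 i) * 'D_(delta_mx 0 i) F).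
    by apply/funext => y; rewrite fct_sumE.
  have DFd i : derivable ('D_(delta_mx 0 i) F) x (A p) by exact/diff_derivable/Fd.
  rewrite derive_sum => [|i]; last by apply: derivableM; [exact: Bdi|exact: DFd].
  rewrite (eq_bigr _ (fun i _ => deriveM (Bdi i) (DFd i))).
  rewrite big_split/=; congr (_ + _).
  - rewrite (smooth_derive_comm oi (B p) (A p) ip FS) (derive_dir_sum _ (Fd _)).
    apply: eq_bigr => i _; rewrite (smooth_derive_comm oi (delta_mx 0 i) (A p) ip FS).
    by rewrite /field_comp /x chart_mapK// tcomp_id.
  - rewrite (derive_dir_sum _ F'd); apply: eq_bigr => i _.
    rewrite -[LHS]/(_ * _) mulrC; congr (_ * _).
    by have [_ ->] := is_derive_coord i BdA.
rewrite (key X Y)// (key Y X)// (smooth_derive_comm oi (X p) (Y p) ip FS) opprD addrACA subrr add0r.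
rewrite /dirder /lie_bracket -/c -/x -/F.
exact: derive_dirB.
Qed.

(** Testing against the coordinate functions of the chart at [p] recovers the
    components of a tangent vector. *)
Lemma vector_eq_dirder W p (v w : 'rV[R]_n) : open W -> W p ->
  (forall f W', open W' -> W' p -> W' `<=` W -> smooth_fun W' f ->
    dirder (fun=> v) f p = dirder (fun=> w) f p) ->
  v = w.
Proof.
move=> oW Wp H; set c := chart_at p; have cp : chart_dom c p by exact: chart_atP.
have oi : open (chart_image c (chart_dom c)) by exact/open_chart_image/chart_dom_open.
have ip : chart_image c (chart_dom c) (chart_map c p) by exact: mem_chart_image.
pose f (j : 'I_n) : M -> R := fun q => chart_map c q 0 j.
have fE j u : dirder (fun=> u) (f j) p = u 0 j.
  rewrite /dirder -/c (@eq_open_derive _ _ _ _ _ (fun y : 'rV[R]_n => y 0 j) _ _ oi ip).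
    have := is_derive_coord j (is_derive_id (chart_map c p) u); by case.
  by move=> y /chart_imageP[_ _ yE]; rewrite /f/= yE.
apply/rowP => j; rewrite -!(fE j); apply: (H _ (W `&` chart_dom c)).
- by apply: openI => //; exact: chart_dom_open.
- by [].
- exact: subIsetl.
- move=> d; have oi' : open (chart_image d (W `&` chart_dom c)).
    by apply/open_chart_image/openI => //; exact: chart_dom_open.
  by refine (smooth_coord oi' j (@smooth_transition _ _ _ d c _ _)) => q [].
Qed.

(** Acting on functions the bracket is a commutator, for which the identity is
    formal; a tangent vector is determined by its action on functions. *)
Lemma jacobi W X Y Z p : open W -> W p ->
  smooth_vfield W X -> smooth_vfield W Y -> smooth_vfield W Z ->
  smooth_vfield W (lie_bracket X Y) -> smooth_vfield W (lie_bracket Y Z) ->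
  smooth_vfield W (lie_bracket Z X) ->
  lie_bracket X (lie_bracket Y Z) p + lie_bracket Y (lie_bracket Z X) p +
  lie_bracket Z (lie_bracket X Y) p = 0.
Proof.
move=> oW Wp XS YS ZS XYS YZS ZXS.
apply: (vector_eq_dirder oW Wp) => f W' oW' W'p W'W fS.
have sub A : smooth_vfield W A -> smooth_vfield W' A by exact: smooth_vfield_sub.
have fd : differentiable (f \o chart_inv (chart_at p)) (chart_map (chart_at p) p).
  exact: (smooth_fun_differentiable oW' W'p (chart_atP p) fS).
have two A B D : smooth_vfield W A -> smooth_vfield W B -> smooth_vfield W D ->
    smooth_vfield W (lie_bracket B D) ->
    dirder (fun=> lie_bracket A (lie_bracket B D) p) f p =
    dirder A (dirder B (dirder D f)) p - dirder A (dirder D (dirder B f)) p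
    - (dirder B (dirder D (dirder A f)) p - dirder D (dirder B (dirder A f)) p).
  move=> AS BS DS BDS.
  have sA := sub _ AS; have sB := sub _ BS; have sD := sub _ DS; have sBD := sub _ BDS.
  rewrite (dirder_at (lie_bracket A (lie_bracket B D))).
  rewrite (dirder_lie_bracket oW' W'p sA sBD fS).
  rewrite (dirder_ext A oW' W'p (g := fun q => dirder B (dirder D f) q - dirder D (dirder B f) q)); last first.
    by move=> q W'q; exact: (dirder_lie_bracket oW' W'q sB sD fS).
  rewrite (dirderB A oW' W'p); do ?by apply: smooth_dirder => //; exact: smooth_dirder.
  by rewrite (dirder_lie_bracket oW' W'p sB sD (smooth_dirder oW' sA fS)).
transitivity (dirder (fun=> lie_bracket X (lie_bracket Y Z) p) f p +
  dirder (fun=> lie_bracket Y (lie_bracket Z X) p) f p +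
  dirder (fun=> lie_bracket Z (lie_bracket X Y) p) f p).
  by rewrite /dirder (derive_dirD _ _ fd) (derive_dirD _ _ fd).
have alg (a b c d e g : R) :
  a - b - (c - d) + (c - e - (g - b)) + (g - d - (a - e)) = 0 by ring.
have add3 (a b c a' b' c' : R) : a = a' -> b = b' -> c = c' -> a + b + c = a' + b' + c'.
  by move=> -> -> ->.
refine (eq_trans (add3 _ _ _ _ _ _ (two X Y Z XS YS ZS YZS) (two Y Z X YS ZS XS ZXS)
  (two Z X Y ZS XS YS XYS)) _).
have -> : dirder (fun=> 0) f p = 0 by exact: derive0.
exact: alg.
Qed.

End DirectionalDerivative.

(** * The metric as a bilinear form *)

Section Inner.
Context (R : realType) (n : nat) (M : smooth_manifold R n) (g : riemannian_metric M).
Implicit Types (p : M) (u v w : 'rV[R]_n).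

Lemma innerDl p u v w : inner g p (u + v) w = inner g p u w + inner g p v w.
Proof. by rewrite /inner /bilin !mulmxDl mxE. Qed.

Lemma innerZl p a u w : inner g p (a *: u) w = a * inner g p u w.
Proof. by rewrite /inner /bilin -!scalemxAl mxE. Qed.

Lemma innerC p u v : inner g p u v = inner g p v u.
Proof. exact: gram_sym. Qed.

Lemma innerDr p u v w : inner g p w (u + v) = inner g p w u + inner g p w v.
Proof. by rewrite innerC innerDl !(innerC p w). Qed.

Lemma innerZr p a u w : inner g p w (a *: u) = a * inner g p w u.
Proof. by rewrite innerC innerZl (innerC p w). Qed.

Lemma innerNl p u w : inner g p (- u) w = - inner g p u w.
Proof. by rewrite -scaleN1r innerZl mulN1r. Qed.

Lemma innerNr p u w : inner g p w (- u) = - inner g p w u.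
Proof. by rewrite -scaleN1r innerZr mulN1r. Qed.

Lemma innerBl p u v w : inner g p (u - v) w = inner g p u w - inner g p v w.
Proof. by rewrite innerDl innerNl. Qed.

Lemma inner0l p w : inner g p 0 w = 0.
Proof. by rewrite -(scale0r (0 : 'rV[R]_n)) innerZl mul0r. Qed.

Lemma inner0r p w : inner g p w 0 = 0.
Proof. by rewrite innerC inner0l. Qed.

Lemma inner_suml p m (u : 'I_m -> 'rV[R]_n) w :
  inner g p (\sum_i u i) w = \sum_i inner g p (u i) w.
Proof.
elim/big_rec2: _ => [|i y1 y2 _ <-]; first exact: inner0l.
exact: innerDl.
Qed.

Lemma inner_sumr p m (u : 'I_m -> 'rV[R]_n) w :
  inner g p w (\sum_i u i) = \sum_i inner g p w (u i).
Proof. by rewrite innerC inner_suml; apply: eq_bigr => i _; rewrite innerC. Qed.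

Lemma inner_eq0 p u : inner g p u u = 0 -> u = 0.
Proof.
move=> u0; apply/eqP/negPn/negP => /(gram_posdef g p).
by rewrite -[bilin _ _ _]/(inner g p u u) u0 ltxx.
Qed.

Lemma inner_gt0 p u : u != 0 -> 0 < inner g p u u.
Proof. exact: gram_posdef. Qed.

Lemma smooth_inner W (X Y : vfield M) : open W -> smooth_vfield W X ->
  smooth_vfield W Y -> smooth_fun W (fun p => inner g p (X p) (Y p)).
Proof. exact: gram_smooth. Qed.

End Inner.

(** * Symmetries of the curvature of the Levi-Civita connection *)

Section LeviCivita.
Context (R : realType) (n : nat) (M : smooth_manifold R n) (g : riemannian_metric M).
Context (nab : connection M) (hnab : is_levi_civita g nab).
Context (W : set M) (oW : open W).
Implicit Types (p : M) (X Y Z T : vfield M).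
Local Notation smooth := (smooth_vfield W).

(** The indicator of the complement of [W] is smooth on [W], being zero there.
    A field that vanishes on [W] is its own product by this function, so the
    product rule shows that its covariant derivatives vanish on [W]. *)
Let outside (q : M) : R := (`[< ~ W q >])%:R.

Let outside0 q : W q -> outside q = 0.
Proof. by move=> Wq; rewrite /outside; case: asboolP. Qed.

Let smooth_outside : smooth_fun W outside.
Proof.
apply: smooth_fun_ext (smooth_fun_cst 0 oW) => // q Wq; exact/esym/outside0.
Qed.

Let outsideZ (X : vfield M) : (forall q, W q -> X q = 0) ->
  X = (fun q => outside q *: X q).
Proof.
move=> X0; apply/funext => q; rewrite /outside.
by case: asboolP => [_|/contrapT/X0->]; rewrite ?scale1r// scaler0.
Qed.

(** The connection acts on globally defined fields and is constrained only where
    they are smooth.  Its locality on [W] is what allows two fields that agree only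
    on [W], such as the bracket and the antisymmetrized covariant derivative, to be
    exchanged under the connection. *)
Lemma nab_addr_local X Y Y' p : smooth X -> smooth Y -> smooth Y' -> W p ->
  (forall q, W q -> Y q = Y' q) -> nab X Y p = nab X Y' p.
Proof.
move=> XS YS YS' Wp YY'.
pose Z q := Y' q - Y q.
have Z0 q : W q -> Z q = 0 by move=> Wq; rewrite /Z YY'// subrr.
have ZS : smooth Z by exact: smooth_vfieldB.
have -> : Y' = (fun q => Y q + Z q) by apply/funext => q; rewrite /Z subrKC.
rewrite (nab_addr hnab oW XS YS ZS Wp) (outsideZ Z0).
rewrite (nab_leibniz hnab oW smooth_outside XS ZS Wp) outside0//.
by rewrite Z0// scaler0 scale0r !addr0.
Qed.

Lemma nabBr X Y Y' p : smooth X -> smooth Y -> smooth Y' -> W p ->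
  nab X (fun q => Y q - Y' q) p = nab X Y p - nab X Y' p.
Proof.
move=> XS YS YS' Wp; apply/(@addIr _ (nab X Y' p)); rewrite subrK.
rewrite -(nab_addr hnab oW XS _ YS' Wp); last exact: smooth_vfieldB.
by congr (nab _ _ _); apply/funext => q; rewrite subrK.
Qed.

Lemma nabNl X Y p : smooth X -> smooth Y -> W p ->
  nab (fun q => - X q) Y p = - nab X Y p.
Proof.
move=> XS YS Wp.
have -> : (fun q => - X q) = (fun q => (-1) *: X q) by apply/funext => q; rewrite scaleN1r.
by rewrite (nab_scalel hnab oW (smooth_fun_cst (-1) oW) XS YS Wp) scaleN1r.
Qed.

Lemma smooth_nab X Y : smooth X -> smooth Y -> smooth (nab X Y).
Proof. exact: (nab_smooth hnab oW). Qed.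

(** On [W] the bracket is the difference of two smooth covariant derivatives. *)
Lemma smooth_lie_bracket X Y : smooth X -> smooth Y -> smooth (lie_bracket X Y).
Proof.
move=> XS YS; apply: smooth_vfield_ext (smooth_vfieldB oW (smooth_nab XS YS) (smooth_nab YS XS)) => //.
by move=> p Wp; exact: (nab_torsion_free hnab oW XS YS Wp).
Qed.

Lemma smooth_curv X Y Z : smooth X -> smooth Y -> smooth Z ->
  smooth (curv nab X Y Z).
Proof.
move=> XS YS ZS; rewrite /curv.
exact: (smooth_vfieldB oW (smooth_vfieldB oW (smooth_nab XS (smooth_nab YS ZS))
  (smooth_nab YS (smooth_nab XS ZS))) (smooth_nab (smooth_lie_bracket XS YS) ZS)).
Qed.

Lemma curv_antisym X Y Z p : smooth X -> smooth Y -> smooth Z -> W p ->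
  curv nab X Y Z p = - curv nab Y X Z p.
Proof.
move=> XS YS ZS Wp; rewrite /curv.
have -> : lie_bracket X Y = (fun q => - lie_bracket Y X q).
  by apply/funext => q; rewrite /lie_bracket opprB.
rewrite (nabNl (smooth_lie_bracket YS XS) ZS Wp).
have alg (a b c : 'rV[R]_n) : a - b - - c = - (b - a - c).
  by apply/rowP => i; rewrite !mxE; ring.
exact: alg.
Qed.

(** Absence of torsion turns the cyclic sum of the curvature into the cyclic sum of
    iterated brackets, which is zero by the Jacobi identity. *)
Lemma curv_bianchi X Y Z p : smooth X -> smooth Y -> smooth Z -> W p ->
  curv nab X Y Z p + curv nab Y Z X p + curv nab Z X Y p = 0.
Proof.
move=> XS YS ZS Wp.
have torsion A B D : smooth A -> smooth B -> smooth D ->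
    nab A (nab B D) p - nab A (nab D B) p - nab (lie_bracket B D) A p =
    lie_bracket A (lie_bracket B D) p.
  move=> AS BS DS; have LS := smooth_lie_bracket BS DS.
  have BDS := smooth_nab BS DS; have DBS := smooth_nab DS BS.
  rewrite -(nabBr AS BDS DBS Wp).
  rewrite (nab_addr_local AS (smooth_vfieldB oW BDS DBS) LS Wp).
    exact: (nab_torsion_free hnab oW AS LS Wp).
  by move=> q Wq; exact: (nab_torsion_free hnab oW BS DS Wq).
have alg (a b c d e f u v w : 'rV[R]_n) :
  a - d - u + (c - f - v) + (e - b - w) = a - b - v + (c - d - w) + (e - f - u).
  by apply/rowP => i; rewrite !mxE; ring.
refine (eq_trans (alg _ _ _ _ _ _ _ _ _) _).
rewrite (torsion X Y Z XS YS ZS) (torsion Y Z X YS ZS XS) (torsion Z X Y ZS XS YS).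
exact: (jacobi oW Wp XS YS ZS (smooth_lie_bracket XS YS) (smooth_lie_bracket YS ZS)
  (smooth_lie_bracket ZS XS)).
Qed.

(** Differentiate the function [h], the inner product of [Z] and [T], twice with the
    metric property: the mixed terms cancel in the commutator of the two
    derivatives, and the commutator is the derivative of [h] along the bracket. *)
Lemma curv_skew X Y Z T p : smooth X -> smooth Y -> smooth Z -> smooth T -> W p ->
  inner g p (curv nab X Y Z p) (T p) = - inner g p (curv nab X Y T p) (Z p).
Proof.
move=> XS YS ZS TS Wp.
pose h q := inner g q (Z q) (T q).
have hS : smooth_fun W h by exact: smooth_inner.
have second A B : smooth A -> smooth B -> dirder A (dirder B h) p =
    inner g p (nab A (nab B Z) p) (T p) + inner g p (nab B Z p) (nab A T p)
    + (inner g p (nab A Z p) (nab B T p) + inner g p (Z p) (nab A (nab B T) p)).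
  move=> AS BS; have BZ := smooth_nab BS ZS; have BT := smooth_nab BS TS.
  rewrite (dirder_ext A oW Wp (fun q Wq => nab_metric hnab oW BS ZS TS Wq)).
  rewrite (dirderD A oW Wp (smooth_inner g oW BZ TS) (smooth_inner g oW ZS BT)).
  rewrite (nab_metric hnab oW AS BZ TS Wp).
  by rewrite (nab_metric hnab oW AS ZS BT Wp).
have LS := smooth_lie_bracket XS YS.
have := dirder_lie_bracket oW Wp XS YS hS.
rewrite (nab_metric hnab oW LS ZS TS Wp) (second X Y XS YS) (second Y X YS XS).
rewrite /curv !innerBl !(innerC g p (Z p)).
set a := inner _ _ (nab (lie_bracket _ _) Z _) _.
set b := inner _ _ (nab (lie_bracket _ _) T _) _.
rewrite (innerC g p (nab X Z p)) (innerC g p (nab Y Z p)) => E.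
have -> : a = a + b - b by rewrite addrK.
rewrite E; ring.
Qed.

End LeviCivita.

(** * Algebraic curvature tensors in dimension three *)

Section Algebra3.
Context (R : realFieldType).

(** The hypotheses say that the symmetric matrix [A] with rows (a, b, c), (b, d, e),
    (c, e, f) has a scalar square, [A * A = m].  The conclusion says that [A] is scalar
    or that [A - (\tr A)%:M] has vanishing minors.
    If [m] is zero then so is [A].  Otherwise let [D] be the determinant of [A]; then
    [A] is its own inverse up to [m], its adjugate is [s *: A] with [s = D / m], and
    [s ^+ 2 = m].  Comparing traces gives [(t - 3 * s) * (t + s) = 0] for the trace
    [t]: the eigenvalues are [s, s, s] or [s, -s, -s].  In the first case the sum of
    the squares of the entries of [A - s] is zero.  In the second one [A - t] is [A + s],
    whose adjugate vanishes because two of its eigenvalues do. *)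
Lemma sym3_square_scalar (a b c d e f : R) :
  a * b + b * d + c * e = 0 -> a * c + b * e + c * f = 0 ->
  b * c + d * e + e * f = 0 ->
  b ^+ 2 + d ^+ 2 + e ^+ 2 = a ^+ 2 + b ^+ 2 + c ^+ 2 ->
  c ^+ 2 + e ^+ 2 + f ^+ 2 = a ^+ 2 + b ^+ 2 + c ^+ 2 ->
  [/\ b = 0, c = 0, e = 0, d = a & f = a] \/
  [/\ (d + f) * (a + f) = b ^+ 2, (d + f) * (a + d) = c ^+ 2,
      (a + f) * (a + d) = e ^+ 2 &
   [/\ - (d + f) * e = b * c, - (a + f) * c = b * e & - (a + d) * b = c * e]].
Proof.
set m := a ^+ 2 + b ^+ 2 + c ^+ 2 => h12 h13 h23 h22 h33.
have m_ge0 : 0 <= m by rewrite /m !addr_ge0 ?sqr_ge0.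
have sq0 (x y z : R) : x ^+ 2 + y ^+ 2 + z ^+ 2 = 0 -> [/\ x = 0, y = 0 & z = 0].
  by move=> H; split; nra.
case: (eqVneq m 0) => [m0|m0].
  have [a0 b0 c0] := sq0 _ _ _ m0.
  rewrite m0 in h22 h33.
  have [_ d0 e0] := sq0 _ _ _ h22; have [_ _ f0] := sq0 _ _ _ h33.
  by left; rewrite a0 b0 c0 d0 e0 f0.
pose D := a * (d * f - e ^+ 2) - b * (b * f - c * e) + c * (b * e - c * d).
pose s := D / m.
have Ds : D = s * m by rewrite /s divfK.
(* the cofactor [y] of an entry [x] of [A] is [s * x]: multiply [A * A = m] by the adjugate *)
have cof x y : D * x = y * m -> y = s * x.
  by move=> H; apply: (mulIf m0); rewrite -H Ds; ring.
have C11 : d * f - e ^+ 2 = s * a.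
  apply: cof; transitivity ((d * f - e ^+ 2) * (a ^+ 2 + b ^+ 2 + c ^+ 2) +
    (c * e - b * f) * (a * b + b * d + c * e) + (b * e - c * d) * (a * c + b * e + c * f)).
    by rewrite /D; ring.
  by rewrite h12 h13 -/m; ring.
have C12 : c * e - b * f = s * b.
  apply: cof; transitivity ((d * f - e ^+ 2) * (a * b + b * d + c * e) +
    (c * e - b * f) * (b ^+ 2 + d ^+ 2 + e ^+ 2) + (b * e - c * d) * (b * c + d * e + e * f)).
    by rewrite /D; ring.
  by rewrite h12 h22 h23; ring.
have C13 : b * e - c * d = s * c.
  apply: cof; transitivity ((d * f - e ^+ 2) * (a * c + b * e + c * f) +
    (c * e - b * f) * (b * c + d * e + e * f) + (b * e - c * d) * (c ^+ 2 + e ^+ 2 + f ^+ 2)).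
    by rewrite /D; ring.
  by rewrite h13 h23 h33; ring.
have C22 : a * f - c ^+ 2 = s * d.
  apply: cof; transitivity ((c * e - b * f) * (a * b + b * d + c * e) +
    (a * f - c ^+ 2) * (b ^+ 2 + d ^+ 2 + e ^+ 2) + (b * c - a * e) * (b * c + d * e + e * f)).
    by rewrite /D; ring.
  by rewrite h12 h22 h23; ring.
have C23 : b * c - a * e = s * e.
  apply: cof; transitivity ((c * e - b * f) * (a * c + b * e + c * f) +
    (a * f - c ^+ 2) * (b * c + d * e + e * f) + (b * c - a * e) * (c ^+ 2 + e ^+ 2 + f ^+ 2)).
    by rewrite /D; ring.
  by rewrite h13 h23 h33; ring.
have C33 : a * d - b ^+ 2 = s * f.
  apply: cof; transitivity ((b * e - c * d) * (a * c + b * e + c * f) +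
    (b * c - a * e) * (b * c + d * e + e * f) + (a * d - b ^+ 2) * (c ^+ 2 + e ^+ 2 + f ^+ 2)).
    by rewrite /D; ring.
  by rewrite h13 h23 h33; ring.
have s2 : s ^+ 2 = m.
  (* the determinant of [A * A] *)
  have D2 : D ^+ 2 = m ^+ 3.
    transitivity ((a ^+ 2 + b ^+ 2 + c ^+ 2) * ((b ^+ 2 + d ^+ 2 + e ^+ 2) *
        (c ^+ 2 + e ^+ 2 + f ^+ 2) - (b * c + d * e + e * f) ^+ 2) -
      (a * b + b * d + c * e) * ((a * b + b * d + c * e) * (c ^+ 2 + e ^+ 2 + f ^+ 2) -
        (b * c + d * e + e * f) * (a * c + b * e + c * f)) +
      (a * c + b * e + c * f) * ((a * b + b * d + c * e) * (b * c + d * e + e * f) -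
        (b ^+ 2 + d ^+ 2 + e ^+ 2) * (a * c + b * e + c * f))).
      by rewrite /D; ring.
    by rewrite h12 h13 h23 h22 h33 -/m; ring.
  apply: (mulIf m0); apply: (mulIf m0); rewrite -[LHS]mulrA -expr2 -exprMn -Ds D2.
  by rewrite !exprS expr0; ring.
pose t := a + d + f.
(* the trace of the adjugate is the second elementary symmetric function of the eigenvalues *)
have tr : (t - 3 * s) * (t + s) = 0.
  have T : t ^+ 2 = 3 * m + 2 * (s * t).
    transitivity ((a ^+ 2 + b ^+ 2 + c ^+ 2) + (b ^+ 2 + d ^+ 2 + e ^+ 2) +
      (c ^+ 2 + e ^+ 2 + f ^+ 2) + 2 * ((d * f - e ^+ 2) + (a * f - c ^+ 2) + (a * d - b ^+ 2))).
      by rewrite /t; ring.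
    by rewrite h22 h33 C11 C22 C33 -/m /t; ring.
  have -> : (t - 3 * s) * (t + s) = t ^+ 2 - 2 * (s * t) - 3 * s ^+ 2 by ring.
  by rewrite T s2; ring.
move/eqP: tr; rewrite mulf_eq0 => /orP[] /eqP ts.
  left; have {}ts : t = 3 * s by apply/eqP; rewrite -subr_eq0 ts.
  have Z : (a - s) ^+ 2 + (d - s) ^+ 2 + (f - s) ^+ 2 + 2 * (b ^+ 2 + c ^+ 2 + e ^+ 2) = 0.
    transitivity ((a ^+ 2 + b ^+ 2 + c ^+ 2) + (b ^+ 2 + d ^+ 2 + e ^+ 2) +
      (c ^+ 2 + e ^+ 2 + f ^+ 2) - 2 * s * t + 3 * s ^+ 2); first by rewrite /t; ring.
    by rewrite h22 h33 ts -/m -s2; ring.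
  have sq (x : R) : x ^+ 2 <= 0 -> x = 0.
    by move=> x0; apply/eqP; rewrite -sqrf_eq0 eq_le x0 sqr_ge0.
  have := sqr_ge0 (a - s); have := sqr_ge0 (d - s); have := sqr_ge0 (f - s).
  have := sqr_ge0 b; have := sqr_ge0 c; have := sqr_ge0 e => e2 c2 b2 f2 d2 a2.
  have a0 := sq (a - s); have d0 := sq (d - s); have f0 := sq (f - s).
  have -> : b = 0 by apply: sq; lra.
  have -> : c = 0 by apply: sq; lra.
  have -> : e = 0 by apply: sq; lra.
  have {}a0 : a - s = 0 by apply: a0; lra.
  have {}d0 : d - s = 0 by apply: d0; lra.
  have {}f0 : f - s = 0 by apply: f0; lra.
  by split; lra.
right; have {}ts : s = - t by apply/eqP; rewrite -addr_eq0 addrC ts.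
rewrite ts /t in C11 C12 C13 C22 C23 C33.
by split; [lra|lra|lra|split; lra].
Qed.

Local Notation o0 := (ord0 : 'I_3).
Local Notation o1 := (lift ord0 ord0 : 'I_3).
Local Notation o2 := (lift ord0 (lift ord0 ord0) : 'I_3).

Lemma sum3 (V : nmodType) (F : 'I_3 -> V) : \sum_i F i = F o0 + F o1 + F o2.
Proof. by rewrite !big_ord_recl big_ord0 addr0 addrA. Qed.

Lemma ord3P (P : 'I_3 -> Prop) : P o0 -> P o1 -> P o2 -> forall i, P i.
Proof.
move=> P0 P1 P2 [[|[|[|//]]] i]; [move: P0|move: P1|move: P2];
  by congr P; apply: val_inj.
Qed.

Lemma sym3_minors (rho : 'I_3 -> 'I_3 -> R) (a b c d e f : R) :
  rho o0 o0 = - (d + f) -> rho o1 o1 = - (a + f) -> rho o2 o2 = - (a + d) ->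
  rho o0 o1 = b -> rho o1 o0 = b -> rho o0 o2 = c -> rho o2 o0 = c ->
  rho o1 o2 = e -> rho o2 o1 = e ->
  (d + f) * (a + f) = b ^+ 2 -> (d + f) * (a + d) = c ^+ 2 ->
  (a + f) * (a + d) = e ^+ 2 -> - (d + f) * e = b * c ->
  - (a + f) * c = b * e -> - (a + d) * b = c * e ->
  forall i j k l, rho i j * rho k l = rho i l * rho k j.
Proof.
move=> rho00 rho11 rho22 rho01 rho10 rho02 rho20 rho12 rho21.
move=> m1 m2 m3 m4 m5 m6.
do 4 apply: ord3P;
  rewrite !(rho00,rho01,rho02,rho10,rho11,rho12,rho20,rho21,rho22);
  first [by ring|by lra].
Qed.

(** A symmetric matrix with vanishing two by two minors is determined by any
    nonzero row: it is its trace times the projection onto that row. *)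
Lemma rank1_entry m (rho : 'I_m -> 'I_m -> R) (i j k : 'I_m) :
  (forall j k, rho j k = rho k j) ->
  (forall i j k l, rho i j * rho k l = rho i l * rho k j) ->
  rho j k * (\sum_l rho i l ^+ 2) = (\sum_l rho l l) * (rho i j * rho i k).
Proof.
move=> sym minors; rewrite mulr_sumr mulr_suml; apply: eq_bigr => l _.
rewrite expr2 mulrA (minors j k i l) mulrAC (sym j l) (mulrC (rho l j)).
by rewrite -(minors i j l l); ring.
Qed.

Context (r : 'I_3 -> 'I_3 -> 'I_3 -> 'I_3 -> R).
Context (anti12 : forall i j k l, r i j k l = - r j i k l).
Context (anti34 : forall i j k l, r i j k l = - r i j l k).
Context (bianchi : forall i j k l, r i j k l + r j k i l + r k i j l = 0).

(** The Ricci contraction. *)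
Let rho j k := \sum_i r i j k i.
Let breve i i' := \sum_j \sum_k \sum_l r i j k l * r i' j k l.

Context (weak : exists c, forall i j, breve i j = c * (i == j)%:R).

(** In dimension three a tensor that is skew in both pairs is a bilinear form [A] on
    bivectors, and the Bianchi identity makes [A] symmetric.  Identifying the
    bivector [12] with [0], [20] with [1] and [01] with [2], the Ricci contraction is
    [A - (\tr A)%:M] and the contraction [breve] is
    [2 *: ((\tr (A * A))%:M - A * A)]; the latter is scalar exactly when the square of
    [A] is, which is the situation of [sym3_square_scalar]. *)
Lemma weakly_einstein_ricci3 :
  (exists c, forall j k, rho j k = c * (j == k)%:R) \/
  ((forall j k, rho j k = rho k j) /\
   (forall i j k l, rho i j * rho k l = rho i l * rho k j)).
Proof.
have rii i k l : r i i k l = 0 by have := anti12 i i k l; lra.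
have rkk i j k : r i j k k = 0 by have := anti34 i j k k; lra.
have s10 := anti12 o1 o0; have s02 := anti12 o0 o2; have s21 := anti12 o2 o1.
have t10 i j := anti34 i j o1 o0; have t02 i j := anti34 i j o0 o2.
have t21 i j := anti34 i j o2 o1.
(* rewrite every component in terms of the pairs 12, 20 and 01 *)
have simp := (rii, rkk, s10, s02, s21, t10, t02, t21).
pose a := r o1 o2 o1 o2; pose d := r o2 o0 o2 o0; pose f := r o0 o1 o0 o1.
pose b := r o1 o2 o2 o0; pose c := r o1 o2 o0 o1; pose e := r o2 o0 o0 o1.
(* the symmetry of [A], one instance of the Bianchi identity for each pair of bivectors *)
have b' : r o2 o0 o1 o2 = b.
  by have := bianchi o0 o1 o2 o2; rewrite !simp /b; lra.
have c' : r o0 o1 o1 o2 = c.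
  by have := bianchi o0 o1 o2 o1; rewrite !simp /c; lra.
have e' : r o0 o1 o2 o0 = e.
  by have := bianchi o0 o1 o2 o0; rewrite !simp /e; lra.
have rho00 : rho o0 o0 = - (d + f) by rewrite /rho sum3 !simp /d /f; ring.
have rho11 : rho o1 o1 = - (a + f) by rewrite /rho sum3 !simp /a /f; ring.
have rho22 : rho o2 o2 = - (a + d) by rewrite /rho sum3 !simp /a /d; ring.
have rho01 : rho o0 o1 = b by rewrite /rho sum3 !simp -b'; ring.
have rho10 : rho o1 o0 = b by rewrite /rho sum3 !simp /b; ring.
have rho02 : rho o0 o2 = c by rewrite /rho sum3 !simp -c'; ring.
have rho20 : rho o2 o0 = c by rewrite /rho sum3 !simp /c; ring.
have rho12 : rho o1 o2 = e by rewrite /rho sum3 !simp -e'; ring.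
have rho21 : rho o2 o1 = e by rewrite /rho sum3 !simp /e; ring.
have [N wk] := weak.
have B i j : breve i j = 2 * (
   r i o0 o1 o2 * r j o0 o1 o2 + r i o0 o2 o0 * r j o0 o2 o0 + r i o0 o0 o1 * r j o0 o0 o1 +
   r i o1 o1 o2 * r j o1 o1 o2 + r i o1 o2 o0 * r j o1 o2 o0 + r i o1 o0 o1 * r j o1 o0 o1 +
   r i o2 o1 o2 * r j o2 o1 o2 + r i o2 o2 o0 * r j o2 o2 o0 + r i o2 o0 o1 * r j o2 o0 o1).
  by rewrite /breve !sum3 !(rkk, t10, t02, t21); ring.
have := wk o0 o0; have := wk o1 o1; have := wk o2 o2.
have := wk o0 o1; have := wk o0 o2; have := wk o1 o2.
rewrite !B !simp b' c' e' -/a -/b -/c -/d -/e -/f !eqxx /= => w12 w02 w01 w22 w11 w00.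
have := @sym3_square_scalar a b c d e f.
case; [by lra|by lra|by lra|by lra|by lra| |] => [[b0 c0 e0 da fa]|[m1 m2 m3 [m4 m5 m6]]].
  left; exists (- (a + a)); apply: ord3P; apply: ord3P; rewrite ?eqxx ?mulr1 ?mulr0;
  rewrite ?(rho00,rho01,rho02,rho10,rho11,rho12,rho20,rho21,rho22); by rewrite ?da ?fa ?b0 ?c0 ?e0 ?mulr0.
right; split.
  by apply: ord3P; apply: ord3P; rewrite !(rho00,rho01,rho02,rho10,rho11,rho12,rho20,rho21,rho22).
by apply: (@sym3_minors _ a b c d e f).
Qed.

End Algebra3.

(** * Expansion in an orthonormal frame *)

Section Frames.
Context (R : realType) (n : nat) (M : smooth_manifold R n) (g : riemannian_metric M).
Implicit Types (W : set M) (e : 'I_n -> vfield M).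

(** Orthonormality reads [E *m G *m E^T = 1%:M] for the matrix [E] of the frame, so
    [G *m E^T] is a right inverse of [E], hence also a left inverse; this says that
    the inner products with the frame are the coefficients. *)
Lemma orthonormal_frame_expand W e p (v : 'rV[R]_n) :
  orthonormal_frame g W e -> W p -> v = \sum_j inner g p v (e j p) *: e j p.
Proof.
move=> [_ eo] Wp; pose E : 'M[R]_n := \matrix_i e i p.
have EGE : E *m (gram g p *m E^T) = 1%:M.
  apply/matrixP => i j; rewrite [RHS]mxE -(eo p Wp i j) mulmxA /inner /bilin.
  rewrite !mxE; apply: eq_bigr => k _; rewrite [in RHS]mxE.
  congr (_ * _); last by rewrite !mxE.
  by rewrite !mxE; apply: eq_bigr => l _; rewrite !mxE.
have vE : v = (v *m (gram g p *m E^T)) *m E.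
  by rewrite -mulmxA (mulmx1C EGE) mulmx1.
rewrite [LHS]vE mulmx_sum_row; apply: eq_bigr => j _.
rewrite rowK; congr (_ *: _).
rewrite mulmxA /inner /bilin !mxE; apply: eq_bigr => k _.
by rewrite !mxE.
Qed.

End Frames.

(** * Almost contact identities and the horizontal part of a field *)

Section AlmostContact.
Context (R : realType) (n : nat) (M : smooth_manifold R n) (S : almost_contact_metric M).
Implicit Types (p : M) (u v : 'rV[R]_n) (W : set M) (X : vfield M).
Local Notation xi := (acm_xi S).
Local Notation phi := (acm_phi S).
Local Notation eta := (acm_eta S).

Lemma etaZ p (a : R) v : eta p (a *: v) = a * eta p v.
Proof. by rewrite /acm_eta /pairing -scalemxAl mxE. Qed.

Lemma eta_xi1 p : eta p (xi p) = 1.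
Proof. exact: eta_xi. Qed.

Lemma xi_neq0 p : xi p != 0.
Proof.
apply/eqP => x0; have := eta_xi1 p; rewrite x0 -(scale0r 0) etaZ mul0r => /esym/eqP.
by rewrite oner_eq0.
Qed.

(** The cube of [phi] computed in two ways. *)
Lemma eta_phi_xi p v : eta p v *: (xi p *m phi p) = eta p (v *m phi p) *: xi p.
Proof.
have := phi_phi S p (v *m phi p); rewrite (phi_phi S p v) mulmxDl mulNmx -scalemxAl.
exact: addrI.
Qed.

Lemma phi_xi p : xi p *m phi p = 0.
Proof.
have E := eta_phi_xi p (xi p); rewrite eta_xi1 scale1r in E.
move: (eta p (xi p *m phi p)) E => a E.
have := phi_phi S p (xi p); rewrite eta_xi scale1r addNr E -scalemxAl E scalerA.
move=> /eqP; rewrite scaler_eq0 (negbTE (xi_neq0 p)) orbF mulf_eq0 orbb => /eqP->.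
by rewrite scale0r.
Qed.

Lemma eta_phi p v : eta p (v *m phi p) = 0.
Proof.
have /esym/eqP := eta_phi_xi p v; rewrite phi_xi scaler0 scaler_eq0.
by rewrite (negbTE (xi_neq0 p)) orbF => /eqP.
Qed.

Lemma eta_inner p v : eta p v = inner S p v (xi p).
Proof.
have := phi_inner S p v (xi p); rewrite phi_xi inner0r eta_xi mulr1 => /esym/eqP.
by rewrite subr_eq0 => /eqP.
Qed.

Lemma xi_unit p : inner S p (xi p) (xi p) = 1.
Proof. by rewrite -eta_inner eta_xi1. Qed.

Lemma phi_inner_hor p u v : eta p u = 0 ->
  inner S p (u *m phi p) (v *m phi p) = inner S p u v.
Proof. by move=> u0; rewrite phi_inner -/(eta p u) u0 mul0r subr0. Qed.

Lemma phi_perp p u : eta p u = 0 -> inner S p (u *m phi p) u = 0.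
Proof.
move=> u0; have := phi_inner_hor (u *m phi p) u0.
rewrite (phi_phi S p u) -/(eta p u) u0 scale0r addr0 innerNr => E.
have := innerC S p u (u *m phi p); rewrite -E => /eqP.
by rewrite eq_sym -addr_eq0 -mulr2n mulrn_eq0/= => /eqP.
Qed.

Definition horizontal X : vfield M := fun p => X p - eta p (X p) *: xi p.

Lemma eta_horizontal X p : eta p (horizontal X p) = 0.
Proof. by rewrite eta_inner innerBl innerZl -!eta_inner eta_xi1 mulr1 subrr. Qed.

Lemma inner_horizontal X p :
  inner S p (horizontal X p) (horizontal X p) = inner S p (X p) (X p) - eta p (X p) ^+ 2.
Proof.
rewrite [X in inner _ _ _ X]/horizontal innerDr innerNr innerZr -eta_inner.
by rewrite eta_horizontal mulr0 subr0 innerBl innerZl [inner _ _ (xi p) _]innerC -eta_inner expr2.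
Qed.

Lemma smooth_eta W X : open W -> smooth_vfield W X -> smooth_fun W (fun p => eta p (X p)).
Proof. exact: eta_smooth. Qed.

Lemma smooth_xi W : smooth_vfield W xi.
Proof. exact: smooth_vfield_sub (@subsetT _ _) (xi_smooth S). Qed.

Lemma smooth_horizontal W X : open W -> smooth_vfield W X -> smooth_vfield W (horizontal X).
Proof.
move=> oW XS.
exact: (smooth_vfieldB oW XS (smooth_vfieldZ oW (smooth_eta oW XS) (@smooth_xi W))).
Qed.

(** The set where the horizontal part of [X] can be normalized, that is, where [X]
    is not a multiple of [xi]. *)
Definition horizontal_dom W X : set M :=
  W `&` [set p | inner S p (horizontal X p) (horizontal X p) != 0].

Definition horizontal_unit X : vfield M := fun p =>
  (Num.sqrt (inner S p (horizontal X p) (horizontal X p)))^-1 *: horizontal X p.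

Lemma open_horizontal_dom W X : open W -> smooth_vfield W X -> open (horizontal_dom W X).
Proof.
move=> oW XS; have HS := smooth_horizontal oW XS.
exact: (open_smooth_neq0 oW (smooth_inner S oW HS HS)).
Qed.

Lemma horizontal_gt0 W X p : horizontal_dom W X p ->
  0 < inner S p (horizontal X p) (horizontal X p).
Proof.
move=> [_ /= h0]; apply: inner_gt0; apply: contra h0 => /eqP->.
by rewrite inner0l.
Qed.

Lemma mem_horizontal_dom W X p : W p -> ~ in_Rxi S p (X p) -> horizontal_dom W X p.
Proof.
move=> Wp nX; split => //=; apply/eqP => /inner_eq0 /eqP.
by rewrite subr_eq0 => /eqP E; apply: nX; exists (eta p (X p)).
Qed.

Lemma smooth_horizontal_unit W X : open W -> smooth_vfield W X ->
  smooth_vfield (horizontal_dom W X) (horizontal_unit X).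
Proof.
move=> oW XS; have oN := open_horizontal_dom oW XS.
have XN : smooth_vfield (horizontal_dom W X) X by apply: smooth_vfield_sub XS => q [].
have HN := smooth_horizontal oN XN.
apply: (smooth_vfieldZ oN _ HN); apply: (smooth_funV oN) => [q Nq|].
  by rewrite gt_eqF// sqrtr_gt0 (horizontal_gt0 Nq).
apply: (smooth_fun_sqrt oN) => [q Nq|]; first exact: horizontal_gt0 Nq.
exact: smooth_inner.
Qed.

Lemma horizontal_unitK W X p : horizontal_dom W X p ->
  X p = Num.sqrt (inner S p (horizontal X p) (horizontal X p)) *: horizontal_unit X p
    + eta p (X p) *: xi p.
Proof.
move=> /horizontal_gt0; rewrite -sqrtr_gt0 => /gt_eqF/negbT s0.
by rewrite /horizontal_unit scalerA divff// scale1r subrK.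
Qed.

Lemma horizontal_unit1 W X p : horizontal_dom W X p ->
  inner S p (horizontal_unit X p) (horizontal_unit X p) = 1.
Proof.
move=> /horizontal_gt0 h0; rewrite innerZl innerZr mulrA -invfM -expr2.
by rewrite sqr_sqrtr ?ltW// mulVf// gt_eqF.
Qed.

Lemma eta_horizontal_unit X p : eta p (horizontal_unit X p) = 0.
Proof. by rewrite etaZ eta_horizontal mulr0. Qed.

End AlmostContact.

(** * Local phi-orthonormal frames *)

Section PhiFrames.
Context (R : realType) (M : smooth_manifold R 3) (S : almost_contact_metric M).
Implicit Types (p : M) (W : set M) (X : vfield M).

(** A field that is nowhere a multiple of [xi] determines a frame: normalize its
    horizontal part to get the first vector, apply [phi] to get the second. *)
Lemma phi_frame_of W X : open W -> smooth_vfield W X ->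
  phi_orthonormal_frame S (horizontal_dom S W X) (horizontal_unit S X)
    (fun p => horizontal_unit S X p *m acm_phi S p).
Proof.
move=> oW XS; split; last by move=> p _.
have oN := open_horizontal_dom S oW XS; have HS := smooth_horizontal_unit S oW XS.
have PS := phi_smooth S oN HS.
split.
  by apply: ord3P; [exact: HS|exact: PS|exact: smooth_xi].
move=> p Np.
have h0 := eta_horizontal_unit S X p.
have h1 := horizontal_unit1 Np.
have h2 := phi_perp h0.
have h3 := eta_phi S p (horizontal_unit S X p).
have h4 := phi_inner_hor (horizontal_unit S X p) h0.
rewrite h1 in h4; rewrite !eta_inner in h0 h3.
apply: ord3P; apply: ord3P; rewrite /frame3 !(tnth_nth (acm_xi S)) /=.
- exact: h1.
- by rewrite innerC h2.
- exact: h0.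
- exact: h2.
- exact: h4.
- exact: h3.
- by rewrite innerC h0.
- by rewrite innerC h3.
- exact: xi_unit.
Qed.

Lemma exists_not_Rxi p : exists v : 'rV[R]_3, ~ in_Rxi S p v.
Proof.
apply: contrapT => H.
have {}H v : in_Rxi S p v by apply: contrapT => nv; apply: H; exists v.
have [a Ea] := H (delta_mx 0 ord0); have [b Eb] := H (delta_mx 0 ord_max).
have := congr1 (fun v : 'rV[R]_3 => v 0 ord0) Ea.
have := congr1 (fun v : 'rV[R]_3 => v 0 ord_max) Ea.
have := congr1 (fun v : 'rV[R]_3 => v 0 ord_max) Eb.
rewrite !mxE !eqxx/= => E1 E2 E3.
have a0 : a != 0 by apply/eqP => a0; move: E3; rewrite a0 mul0r => /eqP; rewrite oner_eq0.
move/esym/eqP: E2; rewrite mulf_eq0 (negbTE a0)/= => /eqP x0.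
by move: E1; rewrite x0 mulr0 => /eqP; rewrite oner_eq0.
Qed.

(** Local frames exist around every point, so hypotheses that quantify over local
    orthonormal frames are not vacuous. *)
Lemma exists_phi_frame p W : open W -> W p ->
  exists (N : set M) (e1 e2 : vfield M),
    [/\ open N, N p, N `<=` W & phi_orthonormal_frame S N e1 e2].
Proof.
move=> oW Wp; have [v nv] := exists_not_Rxi p.
set c := chart_at p; pose X := pushed_field c v.
have oWc : open (W `&` chart_dom c) by apply: openI => //; exact: chart_dom_open.
have XS : smooth_vfield (W `&` chart_dom c) X.
  by apply: smooth_vfield_sub (@smooth_pushed_field _ _ _ c v); exact: subIsetr.
exists (horizontal_dom S (W `&` chart_dom c) X), (horizontal_unit S X),
  (fun p => horizontal_unit S X p *m acm_phi S p).
split; [exact: open_horizontal_dom| |by move=> q [[]]|exact: phi_frame_of].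
by apply: mem_horizontal_dom; [split => //; exact: chart_atP|rewrite /X pushed_field_at].
Qed.

End PhiFrames.

(** * The Ricci operator of a weakly Einstein three-manifold *)

Section RicciRankOne.
Context (R : realType) (M : smooth_manifold R 3) (g : riemannian_metric M).
Context (nab : connection M) (hnab : is_levi_civita g nab).
Context (Q : endo_field M) (hQ : is_ricci_operator g nab Q).
Context (N : set M) (oN : open N) (e : 'I_3 -> vfield M).
Context (eN : orthonormal_frame g N e).

Definition ricci_frame (j k : 'I_3) : M -> R := ricci g nab e (e j) (e k).
Local Notation rho := ricci_frame.

Lemma ricci_operator_frame p j : N p -> e j p *m Q p = \sum_k rho j k p *: e k p.
Proof.
move=> Np; rewrite [LHS](orthonormal_frame_expand _ eN Np).
apply: eq_bigr => k _; congr (_ *: _).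
exact: (hQ oN eN (eN.1 j) (eN.1 k) Np).
Qed.

Lemma smooth_ricci_frame j k : smooth_fun N (rho j k).
Proof.
apply: (smooth_fun_sum oN) => i.
exact: (smooth_inner g oN (smooth_curv hnab oN (eN.1 i) (eN.1 j) (eN.1 k)) (eN.1 i)).
Qed.

Lemma ricci_frame_dichotomy p : N p -> weakly_einstein_on g nab N ->
  (exists c, forall j k, rho j k p = c * (j == k)%:R) \/
  ((forall j k, rho j k p = rho k j p) /\
   (forall i j k l, rho i j p * rho k l p = rho i l p * rho k j p)).
Proof.
move=> Np hweak; have es := eN.1.
apply: (@weakly_einstein_ricci3 R (fun i j k l => curv4 g nab (e i) (e j) (e k) (e l) p)).
- move=> i j k l; rewrite /curv4 -innerNl; congr (inner _ _ _ _).
  exact: (curv_antisym hnab oN (es i) (es j) (es k) Np).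
- move=> i j k l; exact: (curv_skew hnab oN (es i) (es j) (es k) (es l) Np).
- move=> i j k l; rewrite /curv4 -!innerDl.
  by rewrite (curv_bianchi hnab oN (es i) (es j) (es k) Np) inner0l.
- exists (curv_norm2 g nab e p / 3%:R) => i j.
  rewrite -(eN.2 p Np i j).
  exact: (hweak N e (e i) (e j) oN (@subset_refl _ N) eN (es i) (es j) p Np).
Qed.

Lemma scalar_ricci_einstein p c : N p ->
  (forall j k, rho j k p = c * (j == k)%:R) -> einstein_at Q p.
Proof.
move=> Np rc; exists c => v.
rewrite (orthonormal_frame_expand v eN Np) mulmx_suml scaler_sumr.
apply: eq_bigr => j _; rewrite -scalemxAl (ricci_operator_frame j Np) (bigD1 j)//=.
rewrite rc eqxx mulr1 big1 ?addr0 => [|k kj]; first by rewrite scalerA mulrC -scalerA.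
by rewrite rc eq_sym (negbTE kj) mulr0 scale0r.
Qed.

(** The rank one form of the Ricci operator, with [V] the normalized image of a frame
    vector [e i] that the operator does not kill and [lam] the trace.  This choice of
    [lam] and [V] is rational in the Ricci components up to a square root, hence as
    smooth as they are. *)
Lemma rank_one_ricci (i : 'I_3) (lam nrm : R) (V : 'rV[R]_3) p : N p ->
  nrm = \sum_l rho i l p ^+ 2 -> nrm != 0 -> lam = \sum_l rho l l p ->
  V = (Num.sqrt nrm)^-1 *: \sum_l rho i l p *: e l p ->
  (forall j k, rho j k p = rho k j p) ->
  (forall i j k l, rho i j p * rho k l p = rho i l p * rho k j p) ->
  [/\ lam != 0, inner g p V V = 1 &
    forall x : 'rV[R]_3, x *m Q p = (lam * inner g p x V) *: V].
Proof.
move=> Np nrmE nrm0 lamE VE sym minors.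
have nrm_gt0 : 0 < nrm.
  by rewrite lt_def nrm0 nrmE sumr_ge0// => l _; exact: sqr_ge0.
have s2 : (Num.sqrt nrm)^-1 * (Num.sqrt nrm)^-1 = nrm^-1.
  by rewrite -invfM -expr2 sqr_sqrtr// ltW.
have entry j k : rho j k p = lam * ((Num.sqrt nrm)^-1 * rho i j p) * ((Num.sqrt nrm)^-1 * rho i k p).
  apply: (mulIf nrm0); rewrite {1}nrmE (rank1_entry i j k sym minors) -lamE.
  transitivity (lam * (rho i j p * rho i k p) * ((Num.sqrt nrm)^-1 * (Num.sqrt nrm)^-1 * nrm)).
    by rewrite s2 mulVf// mulr1.
  by ring.
have eV j : inner g p (e j p) V = (Num.sqrt nrm)^-1 * rho i j p.
  rewrite VE innerZr inner_sumr; congr (_ * _).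
  rewrite (bigD1 j)//= innerZr (eN.2 p Np) eqxx mulr1 big1 ?addr0// => k kj.
  by rewrite innerZr (eN.2 p Np) eq_sym (negbTE kj) mulr0.
split.
- apply/eqP => lam0; move/eqP: nrm0; apply; rewrite nrmE big1// => l _.
  by rewrite entry lam0 !mul0r expr0n.
- rewrite {1}VE innerZl inner_suml.
  under eq_bigr => l _ do rewrite innerZl eV mulrCA -expr2.
  by rewrite -mulr_sumr -nrmE mulrA s2 mulVf.
- move=> x; rewrite (orthonormal_frame_expand x eN Np) mulmx_suml inner_suml mulr_sumr scaler_suml.
  apply: eq_bigr => j _; rewrite -scalemxAl (ricci_operator_frame j Np) innerZl eV.
  rewrite VE mulrCA -scalerA; congr (_ *: _).
  rewrite !scaler_sumr; apply: eq_bigr => k _.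
  by rewrite !scalerA entry mulrA.
Qed.

End RicciRankOne.

Lemma weakly_einstein_on_sub (R : realType) n (M : smooth_manifold R n)
  (g : riemannian_metric M) (nab : connection M) (U N : set M) :
  N `<=` U -> weakly_einstein_on g nab U -> weakly_einstein_on g nab N.
Proof.
move=> NU H W e X Y oW WN; apply: H => //; exact: subset_trans NU.
Qed.

(** Near [p] the algebraic dichotomy holds at every point and its scalar branch is
    excluded, hence the minors of the Ricci components vanish; some row of
    components is nonzero at [p], and remains so nearby. *)
Lemma weakly_einstein_local_rank_one (R : realType) (M : smooth_manifold R 3)
  (S : almost_contact_metric M)
  (nab : connection M) (hnab : is_levi_civita S nab)
  (Q : endo_field M) (hQ : is_ricci_operator S nab Q)
  (U : set M) (hU : open U)
  (hweak : weakly_einstein_on S nab U)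
  (hnonE : forall p, U p -> ~ einstein_at Q p) (p : M) : U p ->
  exists (W : set M) (lam : M -> R) (V : vfield M),
    [/\ open W, W p & W `<=` U] /\
    [/\ smooth_fun W lam, (forall q, W q -> lam q != 0),
        smooth_vfield W V, (forall q, W q -> inner S q (V q) (V q) = 1) &
        (forall q, W q -> forall x : 'rV[R]_3,
           x *m Q q = (lam q * inner S q x (V q)) *: V q)].
Proof.
move=> Up; have [N [e1 [e2 [oN Np NU [eN _]]]]] := exists_phi_frame S hU Up.
set e := frame3 e1 e2 (acm_xi S) in eN; pose rho := ricci_frame S nab e.
have hweakN := weakly_einstein_on_sub NU hweak.
have rhoS j k : smooth_fun N (rho j k) := smooth_ricci_frame hnab oN eN j k.
have rank q : N q -> (forall j k, rho j k q = rho k j q) /\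
   (forall i j k l, rho i j q * rho k l q = rho i l q * rho k j q).
  move=> Nq; have [[c rc]|//] := ricci_frame_dichotomy hnab oN eN Nq hweakN.
  by case: (hnonE q (NU q Nq)); exact: (scalar_ricci_einstein hQ oN eN Nq rc).
pose nrm i q := \sum_l rho i l q ^+ 2.
have nrmS i : smooth_fun N (nrm i).
  by apply: (smooth_fun_sum oN) => l; exact: (smooth_funM oN (rhoS i l) (rhoS i l)).
have [i nrm0] : exists i, nrm i p != 0.
  apply: contrapT => H; apply: (hnonE p Up).
  apply: (scalar_ricci_einstein hQ oN eN Np (c := 0)) => j k; rewrite mul0r.
  have nj0 : nrm j p = 0.
    by apply/eqP; apply: contrapT => /negP nj; apply: H; exists j.
  apply/eqP; rewrite -sqrf_eq0; apply/eqP.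
  exact: (psumr_eq0P (fun l _ => sqr_ge0 (rho j l p)) nj0 (i := k) isT).
pose W := N `&` [set q | nrm i q != 0].
have WN : W `<=` N by exact: subIsetl.
have oW : open W by exact: (open_smooth_neq0 oN (nrmS i)).
have rhoW j k : smooth_fun W (rho j k) := smooth_fun_sub WN (rhoS j k).
have nrm_gt0 q : W q -> 0 < nrm i q.
  by move=> [_ /= q0]; rewrite lt_def q0 sumr_ge0// => l _; exact: sqr_ge0.
pose lam q := \sum_l rho l l q.
pose V : vfield M := fun q => (Num.sqrt (nrm i q))^-1 *: \sum_l rho i l q *: e l q.
exists W, lam, V; split; first by split => //; exact: subset_trans NU.
have main q : W q -> _ := fun Wq =>
  rank_one_ricci hQ oN eN (WN q Wq) (erefl (nrm i q)) Wq.2 (erefl (lam q)) (erefl (V q))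
    (rank q (WN q Wq)).1 (rank q (WN q Wq)).2.
split.
- by apply: (smooth_fun_sum oW) => l; exact: rhoW.
- by move=> q /main[].
- apply: (smooth_vfieldZ oW).
    apply: (smooth_funV oW) => [q /nrm_gt0|]; first by rewrite -sqrtr_gt0 => /gt_eqF ->.
    exact: (smooth_fun_sqrt oW nrm_gt0 (smooth_fun_sub WN (nrmS i))).
  apply: (smooth_vfield_sum oW) => l.
  exact: (smooth_vfieldZ oW (rhoW i l) (smooth_vfield_sub WN (eN.1 l))).
- by move=> q /main[].
- by move=> q /main[].
Qed.

(** * The three positions of the Ricci direction *)

Theorem theorem4p1 (R : realType) (M : smooth_manifold R 3)
  (S : almost_contact_metric M)
  (nab : connection M) (hnab : is_levi_civita S nab)
  (Q : endo_field M) (hQ : is_ricci_operator S nab Q)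
  (U : set M) (hU : open U)
  (hweak : weakly_einstein_on S nab U)
  (hnonE : forall p, U p -> ~ einstein_at Q p) :
  forall p, U p ->
  exists (W : set M) (lam : M -> R) (V : vfield M),
    [/\ open W, W p & W `<=` U] /\
    [/\ smooth_fun W lam, (forall q, W q -> lam q != 0),
        smooth_vfield W V, (forall q, W q -> inner S q (V q) (V q) = 1) &
        (forall q, W q -> forall x : 'rV[R]_3,
           x *m Q q = (lam q * inner S q x (V q)) *: V q)] /\
    (forall q, W q ->
      [\/ (* (i) *)
          in_D S q (V q) /\
          exists (N : set M) (e1 e2 : vfield M),
            [/\ open N, N q, N `<=` W, phi_orthonormal_frame S N e1 e2 &
             forall y, N y -> in_D S y (V y) ->
               [/\ e1 y *m Q y = lam y *: e1 y,
                   e2 y *m Q y = 0 &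
                   acm_xi S y *m Q y = 0]],
          (* (ii) *)
          in_Rxi S q (V q) /\
          (forall x : 'rV[R]_3, x *m Q q = (lam q * acm_eta S q x) *: acm_xi S q) |
          (* (iii) *)
          [/\ ~ in_D S q (V q), ~ in_Rxi S q (V q) &
          exists (N : set M) (e1 e2 : vfield M) (theta : M -> R),
            [/\ open N, N q, N `<=` W, phi_orthonormal_frame S N e1 e2 &
             smooth_fun N theta /\
             forall y, N y ->
               [/\ V y = sin (theta y) *: e1 y + cos (theta y) *: acm_xi S y,
                   0 < `|sin (theta y)| < 1 &
                   is_matrix_of Q (frame3 e1 e2 (acm_xi S)) y
                     (mx3 [:: [:: lam y * sin (theta y) ^+ 2; 0;
                                  lam y * sin (theta y) * cos (theta y)];
                              [:: 0; 0; 0];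
                              [:: lam y * sin (theta y) * cos (theta y); 0;
                                  lam y * cos (theta y) ^+ 2]])]]]]) /\
    (* (ii), continued *)
    (forall A : set M, open A -> A `<=` W ->
      (forall q, A q -> in_Rxi S q (V q)) -> eta_einstein_on S nab A).
Proof.
move=> p Up.
have [W [lam [V [[oW Wp WU] [lamS lam0 VS V1 QV]]]]] :=
  weakly_einstein_local_rank_one hnab hQ hU hweak hnonE Up.
exists W, lam, V; split => //; split => //.
(* since [V] is a unit field, the squared length of its horizontal part is the squared sine of
   its angle with [xi] *)
have hor1 y : W y -> inner S y (horizontal S V y) (horizontal S V y) = 1 - acm_eta S y (V y) ^+ 2.
  by move=> Wy; rewrite inner_horizontal V1.
have Rxi1 q c : W q -> V q = c *: acm_xi S q -> c * c = 1.
  by move=> Wq Vc; have := V1 q Wq; rewrite Vc innerZl innerZr xi_unit mulr1.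
have QRxi q (x : 'rV[R]_3) : W q -> in_Rxi S q (V q) ->
    x *m Q q = (lam q * acm_eta S q x) *: acm_xi S q.
  move=> Wq [c Vc]; rewrite QV// Vc innerZr -eta_inner scalerA; congr (_ *: _).
  by rewrite -mulrA (mulrC c) -mulrA (Rxi1 q c Wq Vc) mulr1.
pose N := horizontal_dom S W V.
have oN : open N := open_horizontal_dom S oW VS.
have NW : N `<=` W by exact: subIsetl.
pose e1 := horizontal_unit S V; pose e2 : vfield M := fun y => e1 y *m acm_phi S y.
have frame : phi_orthonormal_frame S N e1 e2 := phi_frame_of S oW VS.
split => [q Wq|A oA AW ARxi]; last first.
  exists (fun=> 0), lam; split.
  - exact: smooth_fun_cst.
  - exact: smooth_fun_sub lamS.
  move=> B e X Y oB BA eB XS YS y By.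
  rewrite -(hQ B e X Y oB eB XS YS y By) mul0r add0r.
  rewrite (QRxi y _ (AW y (BA y By)) (ARxi y (BA y By))) innerZl innerC -eta_inner.
  by rewrite mulrA.
have [Vxi|Vxi] := pselect (in_Rxi S q (V q)).
  by constructor 2; split => // x; exact: QRxi.
have Nq : N q by exact: mem_horizontal_dom.
have e1e1 y : N y -> inner S y (e1 y) (e1 y) = 1 by exact: horizontal_unit1.
have e2e1 y : inner S y (e2 y) (e1 y) = 0 by exact/phi_perp/eta_horizontal_unit.
have e2xi y : inner S y (e2 y) (acm_xi S y) = 0 by rewrite -eta_inner eta_phi.
have e1xi y : inner S y (e1 y) (acm_xi S y) = 0 by rewrite -eta_inner eta_horizontal_unit.
have VK y : N y -> V y = Num.sqrt (1 - acm_eta S y (V y) ^+ 2) *: e1 y +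
    acm_eta S y (V y) *: acm_xi S y.
  by move=> Ny; rewrite {1}(horizontal_unitK Ny) (hor1 y (NW y Ny)).
(* from here on [e1] is only known through the identities above *)
clearbody e1.
have [VD|VD] := pselect (in_D S q (V q)).
  constructor 1; split => //; exists N, e1, e2; split => // y Ny yD.
  have Wy := NW y Ny.
  have Ve1 : V y = e1 y.
    rewrite (VK y Ny) yD expr0n subr0 sqrtr1 scale1r.
    by rewrite scale0r addr0.
  split.
  - by rewrite QV// Ve1 (e1e1 y Ny) mulr1.
  - by rewrite QV// {1}Ve1 e2e1 mulr0 scale0r.
  - by rewrite QV// innerC -eta_inner yD mulr0 scale0r.
constructor 3; split => //.
(* the cosine of the angle between [V] and [xi]; the horizontal frame vector is normalized
   with a positive factor, which fits [acos] having values with nonnegative sine *)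
pose c y := acm_eta S y (V y).
have VN : smooth_vfield N V := smooth_vfield_sub NW VS.
have cS : smooth_fun N c := smooth_eta S oN VN.
pose N' := N `&` [set y | c y != 0].
have N'N : N' `<=` N by exact: subIsetl.
have oN' : open N' := open_smooth_neq0 oN cS.
have c1 y : N y -> c y ^+ 2 < 1.
  by move=> Ny; have := horizontal_gt0 Ny; rewrite (hor1 y (NW y Ny)) subr_gt0.
have c11 y : N y -> -1 < c y < 1.
  by move=> Ny; have := c1 y Ny => ?; apply/andP; split; nra.
exists N', e1, e2, (fun y => acos (c y)); split; [exact: oN'| | | |].
- by split; [exact: Nq|apply/eqP => ?; apply: VD].
- exact: subset_trans N'N NW.
- split; [split => [i|y N'y]|by move=> y _].
    exact: smooth_vfield_sub N'N (frame.1.1 i).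
  exact: frame.1.2 (N'N y N'y).
split.
  apply: (smooth_fun_acos oN') => [y N'y|]; first exact/c11/N'N.
  exact: smooth_fun_sub cS.
move=> y N'y; have Ny := N'N y N'y; have Wy := NW y Ny.
have cy1 : -1 <= c y <= 1 by have /andP[? ?] := c11 y Ny; rewrite !ltW.
have cosE : cos (acos (c y)) = c y by exact: acosK.
have sinE : sin (acos (c y)) = Num.sqrt (1 - c y ^+ 2) by exact: sin_acos.
have VE : V y = sin (acos (c y)) *: e1 y + cos (acos (c y)) *: acm_xi S y.
  by rewrite sinE cosE; exact: VK.
split => //.
- rewrite sinE ger0_norm ?sqrtr_ge0// sqrtr_gt0 subr_gt0 (c1 y Ny)/=.
  rewrite -[X in _ < X]sqrtr1 ltr_sqrt// gtrBl exprn_even_gt0//=.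
  by case: N'y.
- set s := sin _ in VE *; set k := cos _ in VE *.
  have Q1 : e1 y *m Q y = (lam y * s) *: V y.
    by rewrite QV// {1}VE innerDr !innerZr (e1e1 y Ny) e1xi mulr1 mulr0 addr0.
  have Q2 : e2 y *m Q y = 0.
    by rewrite QV// {1}VE innerDr !innerZr e2e1 e2xi !mulr0 addr0 mulr0 scale0r.
  have Q3 : acm_xi S y *m Q y = (lam y * k) *: V y.
    rewrite QV// {1}VE innerDr !innerZr xi_unit mulr1.
    by rewrite innerC e1xi mulr0 add0r.
  apply: ord3P; rewrite /frame3 /is_matrix_of sum3 !(tnth_nth (acm_xi S)) !mxE/=.
  - by rewrite Q1 VE scalerDr !scalerA scale0r addr0 expr2 !mulrA.
  - by rewrite Q2 !scale0r !addr0.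
  - by rewrite Q3 VE scalerDr !scalerA scale0r addr0 expr2 !mulrA (mulrAC _ k s).
Qed.
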